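(* Let $\alpha\in(0,1)$, $\beta\in(1,2)$, $\sigma=1-\frac{\alpha}{2}$. The two-dimensional fully discrete scheme in the context is unconditionally stable: there is a positive constant $C$ (independent of $\tau$, $h$ and the data) such that, provided $\tau$ and $h$ are sufficiently small, $$\|\mathbf U^n\|^2_{L^2_h}\le\|\mathbf U^0\|^2_{L^2_h}+\frac{8\pi^{2+\beta}\Gamma(1-\alpha)}{C\,\tilde a^{\alpha}\,2^{\frac{3\beta}{2}}}\max_{0\le k\le n-1}\Big\{\big((k+\sigma)\tau\big)^{\alpha}\|\mathbf F^{k+\sigma}\|^2_{L^2_h}\Big\},\qquad 1\le n\le N.$$
   Context: Time grid: $\tilde a>0$, $T>\tilde a$, $N\in\mathbb{Z}^+$, $\tau=(T-\tilde a)/N$, $t_k=\tilde a+k\tau$, $t_{k+\sigma}=t_k+\sigma\tau$. L2-1$_\sigma$ coefficients: for $1\le i\le k$, $a^{(\alpha,\sigma)}_{i,k}=(\log\frac{t_{k+\sigma}}{t_{i-1}})^{1-\alpha}-(\log\frac{t_{k+\sigma}}{t_{i}})^{1-\alpha}$, $b^{(\alpha,\sigma)}_{i,k}=\frac{1}{\log\frac{t_{i+1}}{t_{i-1}}}\{\frac{2}{2-\alpha}[(\log\frac{t_{k+\sigma}}{t_{i-1}})^{2-\alpha}-(\log\frac{t_{k+\sigma}}{t_{i}})^{2-\alpha}]-\log\frac{t_i}{t_{i-1}}[(\log\frac{t_{k+\sigma}}{t_{i}})^{1-\alpha}+(\log\frac{t_{k+\sigma}}{t_{i-1}})^{1-\alpha}]\}$;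 $c^{(\alpha,\sigma)}_{1,0}=\frac{(\log\frac{t_\sigma}{t_0})^{1-\alpha}}{\Gamma(2-\alpha)\log\frac{t_1}{t_0}}$; for $k\ge1$: $c^{(\alpha,\sigma)}_{1,k}=\frac{a^{(\alpha,\sigma)}_{1,k}-b^{(\alpha,\sigma)}_{1,k}}{\Gamma(2-\alpha)\log\frac{t_1}{t_0}}$, $c^{(\alpha,\sigma)}_{i,k}=\frac{a^{(\alpha,\sigma)}_{i,k}+b^{(\alpha,\sigma)}_{i-1,k}-b^{(\alpha,\sigma)}_{i,k}}{\Gamma(2-\alpha)\log\frac{t_i}{t_{i-1}}}$ ($2\le i\le k$), $c^{(\alpha,\sigma)}_{k+1,k}=\frac{b^{(\alpha,\sigma)}_{k,k}+(\log\frac{t_{k+\sigma}}{t_k})^{1-\alpha}}{\Gamma(2-\alpha)\log\frac{t_{k+1}}{t_k}}$. Space grid: $L>0$, $M\in\mathbb{Z}^+$, $h=2L/M$, $x_j=-L+jh$, $y_k=-L+kh$; grid functions $w=\{w_{jk}\}$ are set to $0$ unless $1\le j,k\le M-1$; $(w,v)_{h^2}=h^2\sum_{j,k=1}^{M-1}w_{jk}v_{jk}$, $\|w\|^2_{L^2_h}=(w,w)_{h^2}$. Fractional centered difference: $((-\Delta_h)^{\beta/2}w)_{jk}=h^{-\beta}\sum_{l,m\in\mathbb{Z}}a^{(\beta)}_{l,m}w_{j+l,k+m}$, $a^{(\beta)}_{l,m}=\frac{1}{4\pi^2}\int_{-\pi}^{\pi}\int_{-\pi}^{\pi}[4\sin^2\frac{\eta_1}{2}+4\sin^2\frac{\eta_2}{2}]^{\beta/2}e^{-\mathbf{i}(\eta_1l+\eta_2m)}d\eta_1d\eta_2$.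 Scheme: given $u_0$ and $f$, let $\mathbf F^{n+\sigma}=(f(x_j,y_k,t_{n+\sigma}))_{j,k}$ and find $\mathbf U^n=(U^n_{jk})$ with $\sum_{i=1}^{n+1}c^{(\alpha,\sigma)}_{i,n}(U^i_{jk}-U^{i-1}_{jk})+\big((-\Delta_h)^{\beta/2}(\sigma U^{n+1}+(1-\sigma)U^n)\big)_{jk}=f(x_j,y_k,t_{n+\sigma})$ for $0\le n\le N-1$, $1\le j,k\le M-1$; $U^0_{jk}=u_0(x_j,y_k)$; $U^n_{jk}=0$ at boundary grid points. *)

(* Defs.v *)
From Stdlib Require Import Reals ZArith.
From Coquelicot Require Import Coquelicot.
Open Scope R_scope.

(* Real power x^y for x > 0 (x^y := 0 for x <= 0; only used at x = 0 in a
   measure-zero point of the Fourier integrand, where 0^(beta/2) = 0). *)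
Definition rpow (x y : R) : R := if Rle_dec x 0 then 0 else Rpower x y.

Definition Gamma (s : R) : R :=
  RInt_gen (fun t => rpow t (s - 1) * exp (- t)) (at_right 0) (Rbar_locally p_infty).

Definition sgm (alpha : R) : R := 1 - alpha / 2.
Definition tau (a T : R) (N : nat) : R := (T - a) / INR N.
Definition tg (a T : R) (N : nat) (s : R) : R := a + s * tau a T N.

Section Coefs.
Variables (alpha a T : R) (N : nat).
Let sg := sgm alpha.
Let t (i : nat) := tg a T N (INR i).
Let ts (k : nat) := tg a T N (INR k + sg).

Definition acoef (i k : nat) : R :=
  rpow (ln (ts k / t (i - 1))) (1 - alpha) - rpow (ln (ts k / t i)) (1 - alpha).

Definition bcoef (i k : nat) : R :=
  / ln (t (i + 1) / t (i - 1)) *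
  (2 / (2 - alpha) * (rpow (ln (ts k / t (i - 1))) (2 - alpha)
                      - rpow (ln (ts k / t i)) (2 - alpha))
   - ln (t i / t (i - 1)) * (rpow (ln (ts k / t i)) (1 - alpha)
                             + rpow (ln (ts k / t (i - 1))) (1 - alpha))).

(* c^{(alpha,sigma)}_{i,k} for 1 <= i <= k+1 (set to 0 otherwise, never used) *)
Definition ccoef (i k : nat) : R :=
  if Nat.eqb k 0 then
    (if Nat.eqb i 1 then rpow (ln (ts 0 / t 0)) (1 - alpha)
                         / (Gamma (2 - alpha) * ln (t 1 / t 0)) else 0)
  else if Nat.eqb i 1 then
    (acoef 1 k - bcoef 1 k) / (Gamma (2 - alpha) * ln (t 1 / t 0))
  else if andb (Nat.leb 2 i) (Nat.leb i k) then
    (acoef i k + bcoef (i - 1) k - bcoef i k) / (Gamma (2 - alpha) * ln (t i / t (i - 1)))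
  else if Nat.eqb i (k + 1) then
    (bcoef k k + rpow (ln (ts k / t k)) (1 - alpha)) / (Gamma (2 - alpha) * ln (t (k + 1) / t k))
  else 0.
End Coefs.

Definition hstep (L : R) (M : nat) : R := 2 * L / INR M.
Definition xg (L : R) (M : nat) (j : nat) : R := - L + INR j * hstep L M.

(* a^{(beta)}_{l,m}; the integrand's factor e^{-i(eta1 l + eta2 m)} is replaced by
   its real part cos(eta1 l + eta2 m): the imaginary part integrates to 0 since the
   weight is even in eta1 and in eta2. *)
Definition afrac (beta : R) (l m : Z) : R :=
  / (4 * PI ^ 2) *
  RInt (fun e1 => RInt (fun e2 =>
          rpow (4 * sin (e1 / 2) ^ 2 + 4 * sin (e2 / 2) ^ 2) (beta / 2)
          * cos (e1 * IZR l + e2 * IZR m)) (- PI) PI) (- PI) PI.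

(* grid functions w : nat -> nat -> R, regarded as 0 outside 1 <= j,k <= M-1 *)
(* ((-Delta_h)^{beta/2} w)_{jk} = h^{-beta} sum_{l,m in Z} a_{l,m} w_{j+l,k+m}
   = h^{-beta} sum_{j',k'=1}^{M-1} a_{j'-j,k'-k} w_{j'k'} *)
Definition fracLap (beta L : R) (M : nat) (w : nat -> nat -> R) (j k : nat) : R :=
  rpow (hstep L M) (- beta) *
  sum_n_m (fun j' => sum_n_m (fun k' =>
     afrac beta (Z.of_nat j' - Z.of_nat j) (Z.of_nat k' - Z.of_nat k) * w j' k')
     1 (M - 1)) 1 (M - 1).

Definition normL2sq (L : R) (M : nat) (w : nat -> nat -> R) : R :=
  hstep L M ^ 2 * sum_n_m (fun j => sum_n_m (fun k => w j k ^ 2) 1 (M - 1)) 1 (M - 1).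

Fixpoint maxupto (g : nat -> R) (n : nat) : R :=
  match n with
  | O => g O
  | S p => Rmax (maxupto g p) (g (S p))
  end.

Definition is_scheme_solution (alpha beta a T L : R) (N M : nat)
  (u0 : R -> R -> R) (f : R -> R -> R -> R) (U : nat -> nat -> nat -> R) : Prop :=
  let sg := sgm alpha in
  (forall n j k, (n <= N)%nat ->
       (j = 0%nat \/ j = M \/ k = 0%nat \/ k = M) -> U n j k = 0) /\
  (forall j k, (1 <= j <= M - 1)%nat -> (1 <= k <= M - 1)%nat ->
       U 0%nat j k = u0 (xg L M j) (xg L M k)) /\
  (forall n j k, (n <= N - 1)%nat -> (1 <= N)%nat ->
       (1 <= j <= M - 1)%nat -> (1 <= k <= M - 1)%nat ->
       sum_n_m (fun i => ccoef alpha a T N i n * (U i j k - U (i - 1)%nat j k)) 1 (n + 1)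
       + fracLap beta L M (fun j' k' => sg * U (n + 1)%nat j' k' + (1 - sg) * U n j' k') j k
       = f (xg L M j) (xg L M k) (tg a T N (INR n + sg))).

Definition Fgrid (alpha a T L : R) (N M : nat) (f : R -> R -> R -> R) (k : nat) :
  nat -> nat -> R :=
  fun j l => f (xg L M j) (xg L M l) (tg a T N (INR k + sgm alpha)).

(* Main.v *)
(* Testing the scheme with V = sigma U^(n+1) + (1 - sigma) U^n reduces the estimate to two facts.

   Space: the discrete fractional Laplacian is coercive uniformly in h. Its quadratic form is the
   integral of the symbol against |v^|^2, where v^ is the Fourier transform of a grid function
   supported on fewer than M^2 points. By Cauchy-Schwarz the strip |eta_1| < pi/(2M) carries at
   most half of the mass of |v^|^2; it is cut off at a comparable width, and outside it the symbol
   is at least of order M^(-beta), which compensates the factor h^(-beta) because h M = 2L.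

   Time: write p = 1 - alpha and d_i = log(t_(k+sigma)/t_i). Then Gamma(2 - alpha) c_(i,k) lies
   between p d_(i-1)^(p-1) and p d_i^(p-1), so the weights are nondecreasing in i and c_(1,k)
   is at least of order a^alpha ((k + sigma) tau)^(-alpha). The last two weights moreover satisfy
   sigma^2 c_(k,k) <= (2 sigma - 1) c_(k+1,k): after rescaling, they depend only on
   q = tau/t_k, and the inequality is strict in the limit q -> 0 of a uniform mesh. These
   properties give (V, sum c_i (U^i - U^(i-1))) >= 1/2 sum c_i (|U^i|^2 - |U^(i-1)|^2), and
   coercivity absorbs V from (F, V); the bound follows by induction on n. *)

Require Import Defs.
From Stdlib Require Import Reals ZArith Lra Lia.
From Coquelicot Require Import Coquelicot.
Open Scope R_scope.

(** * Finite sums and energy inequalities for nondecreasing weights *)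

Definition sum1 (m : nat) (f : nat -> R) : R := sum_n_m f 1 m.

Lemma sum1_0 (f : nat -> R) : sum1 0 f = 0.
Proof. apply (sum_n_m_zero f); lia. Qed.

Lemma sum1_S (f : nat -> R) (m : nat) : sum1 (S m) f = sum1 m f + f (S m).
Proof. apply (sum_n_Sm f 1 m); lia. Qed.

Lemma sum1_ext (f g : nat -> R) (m : nat) :
  (forall i, (1 <= i <= m)%nat -> f i = g i) -> sum1 m f = sum1 m g.
Proof. intros H; apply (sum_n_m_ext_loc f g); exact H. Qed.

Lemma sum1_plus (f g : nat -> R) (m : nat) :
  sum1 m (fun i => f i + g i) = sum1 m f + sum1 m g.
Proof. apply (sum_n_m_plus f g). Qed.

Lemma sum1_scal (c : R) (f : nat -> R) (m : nat) :
  sum1 m (fun i => c * f i) = c * sum1 m f.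
Proof. apply (sum_n_m_mult_l (K := R_Ring) c f). Qed.

Lemma sum1_const (c : R) (m : nat) : sum1 m (fun _ => c) = INR m * c.
Proof. unfold sum1; rewrite sum_n_m_const; f_equal; f_equal; lia. Qed.

Lemma sum1_le (f g : nat -> R) (m : nat) :
  (forall i, (1 <= i <= m)%nat -> f i <= g i) -> sum1 m f <= sum1 m g.
Proof.
  induction m as [|m IH]; intros H.
  - rewrite !sum1_0; lra.
  - rewrite !sum1_S; apply Rplus_le_compat; [apply IH; intros; apply H; lia | apply H; lia].
Qed.

Lemma sum1_nonneg (f : nat -> R) (m : nat) :
  (forall i, (1 <= i <= m)%nat -> 0 <= f i) -> 0 <= sum1 m f.
Proof.
  intros H; replace 0 with (sum1 m (fun _ => 0)) by (rewrite sum1_const; ring).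
  now apply sum1_le.
Qed.

Lemma sum1_swap (f : nat -> nat -> R) (m n : nat) :
  sum1 m (fun i => sum1 n (fun j => f i j)) = sum1 n (fun j => sum1 m (fun i => f i j)).
Proof.
  induction m as [|m IH].
  - rewrite sum1_0; symmetry; rewrite <- (Rmult_0_r (INR n)), <- sum1_const.
    apply sum1_ext; intros; apply sum1_0.
  - rewrite sum1_S, IH, <- sum1_plus; apply sum1_ext; intros; now rewrite sum1_S.
Qed.

Lemma sum1_delta (f : nat -> R) (k m : nat) :
  (1 <= k <= m)%nat -> sum1 m (fun i => if Nat.eq_dec i k then f i else 0) = f k.
Proof.
  revert k; induction m as [|m IH]; intros k Hk; [lia|].
  rewrite sum1_S; destruct (Nat.eq_dec (S m) k) as [<-|E].
  - rewrite (sum1_ext _ (fun _ => 0)), sum1_const; [ring|].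
    intros i Hi; destruct (Nat.eq_dec i (S m)); [lia|reflexivity].
  - rewrite IH by lia; ring.
Qed.

(* For z = s u_m + (1-s) u_(m-1), z (u_i - u_(i-1)) - (u_i^2 - u_(i-1)^2)/2 equals
   ((z - u_(i-1))^2 - (z - u_i)^2)/2; summing by parts, all terms but the last two are
   nonnegative, and those two are controlled by the last hypothesis. *)
Lemma convex_combination_energy (c u : nat -> R) (s : R) (m : nat) :
  (1 <= m)%nat -> 1 / 2 <= s -> 0 <= c 1%nat ->
  (forall i, (1 <= i)%nat -> (i < m)%nat -> c i <= c (S i)) ->
  (forall i, (1 <= i)%nat -> m = S i -> s ^ 2 * c i <= (2 * s - 1) * c m) ->
  1 / 2 * sum1 m (fun i => c i * (u i ^ 2 - u (i - 1)%nat ^ 2))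
  <= (s * u m + (1 - s) * u (m - 1)%nat) * sum1 m (fun i => c i * (u i - u (i - 1)%nat)).
Proof.
  intros Hm Hs Hc1 Hmono Hlast.
  set (z := s * u m + (1 - s) * u (m - 1)%nat).
  (* Invariant of the summation by parts: up to index j only the square at the upper end survives
     with a negative sign. *)
  assert (Hpart : forall j, (1 <= j)%nat -> (j <= m)%nat ->
    1 / 2 * sum1 j (fun i => c i * (u i ^ 2 - u (i - 1)%nat ^ 2)) - 1 / 2 * (c j * (z - u j) ^ 2)
    <= z * sum1 j (fun i => c i * (u i - u (i - 1)%nat))).
  { intros j Hj; induction j as [|j IH]; [lia|]; intros Hjm.
    rewrite !sum1_S; replace (S j - 1)%nat with j by lia.
    destruct j as [|j].
    - rewrite !sum1_0; assert (H := Rmult_le_pos _ _ Hc1 (pow2_ge_0 (z - u 0%nat))); nra.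
    - specialize (IH ltac:(lia) ltac:(lia)).
      assert (H := Rmult_le_pos (c (S (S j)) - c (S j)) _
        ltac:(specialize (Hmono (S j) ltac:(lia) ltac:(lia)); lra) (pow2_ge_0 (z - u (S j)))).
      nra. }
  destruct m as [|m]; [lia|]; destruct m as [|m].
  - rewrite !sum1_S, !sum1_0; simpl (1 - 1)%nat in *.
    assert (H := Rmult_le_pos _ _ Hc1 (pow2_ge_0 (u 1%nat - u 0%nat))).
    unfold z; assert (H2 := Rmult_le_pos (s - 1 / 2) _ ltac:(lra) H); nra.
  - specialize (Hpart (S m) ltac:(lia) ltac:(lia)).
    specialize (Hlast (S m) ltac:(lia) eq_refl).
    rewrite (sum1_S _ (S m)), (sum1_S (fun i => c i * (u i - _)) (S m)).
    replace (S (S m) - 1)%nat with (S m) in * by lia.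
    assert (H := Rmult_le_pos ((2 * s - 1) * c (S (S m)) - s ^ 2 * c (S m)) _
       ltac:(lra) (pow2_ge_0 (u (S (S m)) - u (S m)))).
    (* The surviving square is s^2 times the squared last increment, and the last summand is s - 1/2
       times it; [Hlast] is exactly the comparison of the two. *)
    assert (E1 : z - u (S m) = s * (u (S (S m)) - u (S m))) by (unfold z; simpl (_ - _)%nat; ring).
    assert (E2 : c (S (S m)) * (z * (u (S (S m)) - u (S m))
               - 1 / 2 * (u (S (S m)) ^ 2 - u (S m) ^ 2))
               = c (S (S m)) * (s - 1 / 2) * (u (S (S m)) - u (S m)) ^ 2)
      by (unfold z; simpl (_ - _)%nat; field).
    rewrite E1 in Hpart.
    rewrite Rmult_plus_distr_l, (Rmult_plus_distr_l z).
    nra.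
Qed.

(** Abel summation: the sum is c_m y_m - c_1 y_0 minus the sum of (c_(i+1) - c_i) y_i. These
    differences are nonnegative and add up to c_m - c_1, so E may replace each y_i there. *)
Lemma sum1_increments_lower_bound (c y : nat -> R) (E : R) (m : nat) :
  (1 <= m)%nat ->
  (forall i, (1 <= i)%nat -> (i < m)%nat -> c i <= c (S i)) ->
  (forall i, (1 <= i)%nat -> (i < m)%nat -> y i <= E) ->
  c m * y m - (c m - c 1%nat) * E - c 1%nat * y 0%nat
  <= sum1 m (fun i => c i * (y i - y (i - 1)%nat)).
Proof.
  intros Hm; induction m as [|m IH]; [lia|]; intros Hc Hy.
  rewrite sum1_S; replace (S m - 1)%nat with m by lia.
  destruct m as [|m]; [rewrite sum1_0; nra|].
  specialize (IH ltac:(lia) ltac:(intros; apply Hc; lia) ltac:(intros; apply Hy; lia)).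
  assert (H := Rmult_le_pos (c (S (S m)) - c (S m)) (E - y (S m))
    ltac:(specialize (Hc (S m) ltac:(lia) ltac:(lia)); lra)
    ltac:(specialize (Hy (S m) ltac:(lia) ltac:(lia)); lra)).
  nra.
Qed.

Lemma maxupto_le (g : nat -> R) (n i : nat) : (i <= n)%nat -> g i <= maxupto g n.
Proof.
  induction n as [|n IH]; intros Hi; simpl.
  - replace i with 0%nat by lia; lra.
  - destruct (Nat.eq_dec i (S n)) as [->|]; [apply Rmax_r|].
    eapply Rle_trans; [apply IH; lia | apply Rmax_l].
Qed.

Lemma maxupto_mono (g : nat -> R) (m n : nat) : (m <= n)%nat -> maxupto g m <= maxupto g n.
Proof.
  induction 1 as [|n _ IH]; [lra|]; simpl.
  eapply Rle_trans; [apply IH | apply Rmax_l].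
Qed.

(** * Coercivity of the fractional centered difference *)

Lemma rpow_pos_eq (x y : R) : 0 < x -> rpow x y = Rpower x y.
Proof. intros Hx; unfold rpow; destruct (Rle_dec x 0); [lra|reflexivity]. Qed.

Lemma rpow_nonneg (x y : R) : 0 <= rpow x y.
Proof.
  unfold rpow; destruct (Rle_dec x 0); [lra|]; left; apply exp_pos.
Qed.

Lemma Rpower_pos (x y : R) : 0 < Rpower x y.
Proof. apply exp_pos. Qed.

Lemma Rpower_continuity_pt (x y : R) : 0 < x -> continuity_pt (fun t => Rpower t y) x.
Proof.
  intros Hx; apply derivable_continuous_pt.
  exists (y * Rpower x (y - 1)); now apply derivable_pt_lim_power.
Qed.

(** The delicate point is 0, where the symbol of the Laplacian vanishes; there t < eps^(1/y) yields
    t^y < eps. *)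
Lemma rpow_continuity_pt (x y : R) : 0 < y -> continuity_pt (fun t => rpow t y) x.
Proof.
  intros Hy.
  destruct (Rtotal_order x 0) as [Hx|[->|Hx]].
  - apply continuity_pt_ext_loc with (fun _ => 0).
    + exists (mkposreal (- x) ltac:(lra)); intros t Ht.
      change (Rabs (t - x) < - x) in Ht; apply Rabs_def2 in Ht.
      unfold rpow; destruct (Rle_dec t 0); lra.
    + apply continuity_pt_const; intros ? ?; reflexivity.
  - apply continuity_pt_locally; intros eps.
    exists (mkposreal _ (Rpower_pos eps (/ y))); intros t Ht.
    change (Rabs (t - 0) < Rpower eps (/ y)) in Ht; apply Rabs_def2 in Ht.
    unfold rpow at 2; destruct (Rle_dec 0 0); [|lra].
    rewrite Rminus_0_r, Rabs_pos_eq by apply rpow_nonneg.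
    unfold rpow; destruct (Rle_dec t 0) as [|Ht0]; [apply cond_pos|].
    apply Rlt_le_trans with (Rpower (Rpower eps (/ y)) y).
    + apply Rlt_Rpower_l; lra.
    + rewrite Rpower_mult, Rinv_l, Rpower_1 by (try apply cond_pos; lra); lra.
  - apply continuity_pt_ext_loc with (fun t => Rpower t y).
    + exists (mkposreal x Hx); intros t Ht.
      change (Rabs (t - x) < x) in Ht; apply Rabs_def2 in Ht.
      symmetry; apply rpow_pos_eq; lra.
    + now apply Rpower_continuity_pt.
Qed.

(** * Iterated integrals over the square of jointly continuous functions *)

Definition cont2 (g : R -> R -> R) : Prop := forall x y, continuity_2d_pt g x y.

Lemma cont2_mult (f g : R -> R -> R) :
  cont2 f -> cont2 g -> cont2 (fun x y => f x y * g x y).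
Proof. intros Hf Hg x y; now apply continuity_2d_pt_mult. Qed.

Lemma cont2_const (c : R) : cont2 (fun _ _ => c).
Proof. intros x y; apply continuity_2d_pt_const. Qed.

Lemma cont2_sum1 (f : nat -> R -> R -> R) (n : nat) :
  (forall i, cont2 (f i)) -> cont2 (fun x y => sum1 n (fun i => f i x y)).
Proof.
  intros Hf; induction n as [|n IH]; intros x y.
  - apply continuity_2d_pt_ext with (fun _ _ => 0); [|apply cont2_const].
    intros; now rewrite sum1_0.
  - apply continuity_2d_pt_ext with (fun x y => sum1 n (fun i => f i x y) + f (S n) x y).
    + intros; now rewrite sum1_S.
    + apply continuity_2d_pt_plus; [apply IH | apply Hf].
Qed.

Lemma cont2_cos (l m : R) : cont2 (fun x y => cos (x * l + y * m)).
Proof.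
  intros x y.
  apply (continuity_1d_2d_pt_comp cos (fun x y => x * l + y * m)); [apply continuity_cos|].
  apply continuity_2d_pt_plus; apply continuity_2d_pt_mult;
    first [apply continuity_2d_pt_id1 | apply continuity_2d_pt_id2 | apply continuity_2d_pt_const].
Qed.

Lemma cont2_slice (g : R -> R -> R) (x y : R) : cont2 g -> continuous (g x) y.
Proof.
  intros Hg; apply continuity_pt_filterlim, continuity_pt_locally; intros eps.
  destruct (Hg x y eps) as [d Hd]; exists d; intros z Hz.
  apply Hd; [rewrite Rminus_diag, Rabs_R0; apply cond_pos | exact Hz].
Qed.

Lemma cont2_ex_RInt (g : R -> R -> R) (x a b : R) : cont2 g -> ex_RInt (g x) a b.
Proof. intros Hg; apply (ex_RInt_continuous (g x)); intros; now apply cont2_slice. Qed.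

(** By uniform continuity on the compact rectangle [x-1, x+1] x [a, b], the integral moves by at
    most b - a times the oscillation of g. *)
Lemma cont2_RInt_continuous (g : R -> R -> R) (a b x : R) :
  a <= b -> cont2 g -> continuous (fun x => RInt (g x) a b) x.
Proof.
  intros Hab Hg; apply continuity_pt_filterlim, continuity_pt_locally; intros eps.
  (* The [+ 1] covers a = b and makes the final inequality strict. *)
  assert (He : 0 < eps / (b - a + 1)) by (apply Rdiv_lt_0_compat; [apply cond_pos|lra]).
  destruct (uniform_continuity_2d g (x - 1) (x + 1) a b (fun x y _ _ => Hg x y)
    (mkposreal _ He)) as [d Hd]; simpl in Hd.
  exists (mkposreal _ (Rmin_stable_in_posreal d (mkposreal 1 Rlt_0_1))); intros z Hz.
  change (Rabs (z - x) < Rmin d 1) in Hz.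
  assert (Hz1 := Rlt_le_trans _ _ _ Hz (Rmin_l _ _)).
  assert (Hz2 := Rlt_le_trans _ _ _ Hz (Rmin_r _ _)); apply Rabs_def2 in Hz2.
  rewrite <- (RInt_minus (V := R_CompleteNormedModule) (g z) (g x)) by now apply cont2_ex_RInt.
  apply Rle_lt_trans with ((b - a) * (eps / (b - a + 1))).
  - apply abs_RInt_le_const; [exact Hab| |].
    + apply (ex_RInt_minus (V := R_CompleteNormedModule)); now apply cont2_ex_RInt.
    + intros t Ht; left; apply Hd; try lra.
      rewrite Rminus_diag, Rabs_R0; apply cond_pos.
  - assert (H : eps = (b - a + 1) * (eps / (b - a + 1)) :> R) by (field; lra).
    rewrite H at 2; nra.
Qed.

Definition RInt2 (g : R -> R -> R) : R := RInt (fun x => RInt (g x) (- PI) PI) (- PI) PI.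

Lemma PI_sym : - PI <= PI.
Proof. generalize PI_RGT_0; lra. Qed.

Lemma cont2_ex_RInt_outer (g : R -> R -> R) (a b : R) :
  cont2 g -> ex_RInt (fun x => RInt (g x) (- PI) PI) a b.
Proof.
  intros Hg; apply (ex_RInt_continuous (fun x => RInt (g x) (- PI) PI)); intros.
  apply cont2_RInt_continuous; [apply PI_sym | exact Hg].
Qed.

Lemma RInt2_ext (f g : R -> R -> R) : (forall x y, f x y = g x y) -> RInt2 f = RInt2 g.
Proof.
  intros H; apply RInt_ext; intros x _; apply RInt_ext; intros y _; apply H.
Qed.

Lemma RInt2_plus (f g : R -> R -> R) :
  cont2 f -> cont2 g -> RInt2 (fun x y => f x y + g x y) = RInt2 f + RInt2 g.
Proof.
  intros Hf Hg; unfold RInt2.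
  rewrite <- (RInt_plus (V := R_CompleteNormedModule) (fun x => RInt (f x) (- PI) PI))
    by now apply cont2_ex_RInt_outer.
  apply RInt_ext; intros x _.
  apply (RInt_plus (V := R_CompleteNormedModule) (f x) (g x)); now apply cont2_ex_RInt.
Qed.

Lemma RInt2_scal (c : R) (f : R -> R -> R) :
  cont2 f -> RInt2 (fun x y => c * f x y) = c * RInt2 f.
Proof.
  intros Hf; unfold RInt2.
  rewrite <- (RInt_scal (V := R_CompleteNormedModule) (fun x => RInt (f x) (- PI) PI))
    by now apply cont2_ex_RInt_outer.
  apply RInt_ext; intros x _.
  apply (RInt_scal (V := R_CompleteNormedModule) (f x)); now apply cont2_ex_RInt.
Qed.

Lemma RInt2_sum1 (f : nat -> R -> R -> R) (n : nat) :
  (forall i, cont2 (f i)) ->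
  RInt2 (fun x y => sum1 n (fun i => f i x y)) = sum1 n (fun i => RInt2 (f i)).
Proof.
  intros Hf; induction n as [|n IH].
  - rewrite sum1_0, (RInt2_ext _ (fun x y => 0 * 0)) by (intros; rewrite sum1_0; ring).
    rewrite (RInt2_scal 0 (fun _ _ => 0)) by apply cont2_const; ring.
  - rewrite sum1_S, <- IH, <- RInt2_plus by (try apply cont2_sum1; apply Hf).
    apply RInt2_ext; intros; now rewrite sum1_S.
Qed.

(** * Orthogonality of the characters and mass outside a strip *)

Lemma sin_IZR_PI (m : Z) : sin (IZR m * PI) = 0.
Proof. apply sin_eq_0_1; now exists m. Qed.

(** The free phase A carries the contribution of the other variable when one integrates in a single
    variable. *)
Lemma is_RInt_cos_IZR (A : R) (m : Z) :
  is_RInt (fun y => cos (A + y * IZR m)) (- PI) PI (if Z.eq_dec m 0 then 2 * PI * cos A else 0).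
Proof.
  destruct (Z.eq_dec m 0) as [->|Hm].
  - apply is_RInt_ext with (fun _ => cos A).
    + intros; f_equal; ring.
    + replace (2 * PI * cos A) with (scal (PI - - PI) (cos A))
        by (unfold scal; simpl; unfold mult; simpl; ring).
      apply (is_RInt_const (V := R_NormedModule)).
  - assert (Hm' : IZR m <> 0) by now apply not_0_IZR.
    replace 0 with (minus (sin (A + PI * IZR m) / IZR m) (sin (A + - PI * IZR m) / IZR m)).
    2:{ unfold minus, plus, opp; simpl.
        rewrite !sin_plus, Ropp_mult_distr_l_reverse, sin_neg, cos_neg.
        rewrite (Rmult_comm PI), sin_IZR_PI; field; exact Hm'. }
    apply (is_RInt_derive (fun y => sin (A + y * IZR m) / IZR m)).
    + intros x _; auto_derive; [trivial|]; field; exact Hm'.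
    + intros x _; apply (cont2_slice (fun A y => cos (A + y * IZR m)) A).
      intros u v; apply continuity_2d_pt_ext with (fun u v => cos (u * 1 + v * IZR m)).
      * intros; f_equal; ring.
      * apply cont2_cos.
Qed.

Lemma is_RInt_sum1 (f : nat -> R -> R) (I : nat -> R) (a b : R) (n : nat) :
  (forall i, (1 <= i <= n)%nat -> is_RInt (f i) a b (I i)) ->
  is_RInt (fun y => sum1 n (fun i => f i y)) a b (sum1 n I).
Proof.
  induction n as [|n IH]; intros H.
  - apply is_RInt_ext with (fun _ => 0); [intros; now rewrite sum1_0|].
    replace (sum1 0 I) with ((b - a) * 0) by (rewrite sum1_0; ring).
    apply (is_RInt_const a b 0).
  - apply is_RInt_ext with (fun y => sum1 n (fun i => f i y) + f (S n) y).
    + intros; now rewrite sum1_S.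
    + rewrite sum1_S; apply (is_RInt_plus (V := R_NormedModule)); [|apply H; lia].
      apply IH; intros; apply H; lia.
Qed.

Lemma sum1_delta_Z (f : nat -> R) (k m : nat) :
  (1 <= k <= m)%nat ->
  sum1 m (fun i => if Z.eq_dec (Z.of_nat i - Z.of_nat k) 0 then f i else 0) = f k.
Proof.
  intros Hk; rewrite <- (sum1_delta f k m Hk); apply sum1_ext; intros i _.
  destruct (Z.eq_dec _ 0), (Nat.eq_dec i k); solve [reflexivity | lia].
Qed.

(* Cutting out the strip [|x| < r] costs at most [2 r B] of the total mass [K]. *)
Lemma RInt2_lower_bound (W T : R -> R -> R) (P : R -> R) (delta r B K : R) :
  cont2 W -> cont2 T -> 0 < r < PI -> 0 <= delta ->
  (forall x y, 0 <= W x y) -> (forall x y, 0 <= T x y) ->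
  (forall x y, r <= Rabs x <= PI -> delta <= W x y) ->
  (forall x, is_RInt (T x) (- PI) PI (2 * PI * P x)) ->
  (forall x, P x <= B) -> is_RInt P (- PI) PI K ->
  delta * (2 * PI) * (K - 2 * r * B) <= RInt2 (fun x y => W x y * T x y).
Proof.
  intros HW HT Hr Hd HW0 HT0 HWd HTP HPB HPK.
  assert (HPI := PI_RGT_0).
  set (G := (fun x => RInt (fun y => W x y * T x y) (- PI) PI) : R -> R).
  assert (HWT : cont2 (fun x y => W x y * T x y)) by now apply cont2_mult.
  assert (HG : forall a b, ex_RInt G a b) by (intros; now apply cont2_ex_RInt_outer).
  assert (HG0 : forall x, 0 <= G x).
  { intros x; apply RInt_ge_0; [apply PI_sym | exact (cont2_ex_RInt _ x _ _ HWT) |].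
    intros; now apply Rmult_le_pos. }
  assert (HGP : forall x, r <= Rabs x <= PI -> delta * (2 * PI) * P x <= G x).
  { intros x Hx; rewrite Rmult_assoc, <- (is_RInt_unique _ _ _ _ (HTP x)).
    rewrite <- (RInt_scal (V := R_CompleteNormedModule) (T x)) by now apply cont2_ex_RInt.
    apply RInt_le; [apply PI_sym | | exact (cont2_ex_RInt _ x _ _ HWT) |].
    - apply (ex_RInt_scal (V := R_CompleteNormedModule)); now apply cont2_ex_RInt.
    - intros y _; apply Rmult_le_compat_r; [apply HT0 | now apply HWd]. }
  assert (HP : ex_RInt P (- PI) PI) by now exists K.
  assert (HP' : forall a b, - PI <= a -> a <= b -> b <= PI -> ex_RInt P a b).
  { intros a b Ha Hab Hb; apply (ex_RInt_Chasles_1 (V := R_CompleteNormedModule)) with PI; [lra|].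
    apply (ex_RInt_Chasles_2 (V := R_CompleteNormedModule)) with (- PI); [lra|exact HP]. }
  assert (Hside : forall a b, a <= b -> - PI <= a -> b <= PI ->
    (forall x, a < x < b -> r <= Rabs x <= PI) -> delta * (2 * PI) * RInt P a b <= RInt G a b).
  { intros a b Hab Ha Hb Hx.
    rewrite <- (RInt_scal (V := R_CompleteNormedModule) P) by (apply HP'; lra).
    apply RInt_le; [exact Hab | | apply HG |].
    - apply (ex_RInt_scal (V := R_CompleteNormedModule)), HP'; lra.
    - intros x H; now apply HGP, Hx. }
  (* The two outer pieces keep the factor delta; on the strip, G is only known to be nonnegative and
     P has integral at most 2 r B. *)
  assert (H1 := Hside (- PI) (- r) ltac:(lra) ltac:(lra) ltac:(lra)
    ltac:(intros; rewrite Rabs_left by lra; lra)).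
  assert (H2 := Hside r PI ltac:(lra) ltac:(lra) ltac:(lra)
    ltac:(intros; rewrite Rabs_pos_eq by lra; lra)).
  assert (H3 : 0 <= RInt G (- r) r) by (apply RInt_ge_0; [lra | apply HG | intros; apply HG0]).
  assert (H4 : RInt P (- r) r <= 2 * r * B).
  { replace (2 * r * B) with (RInt (fun _ => B) (- r) r).
    - apply RInt_le; [lra | apply HP'; lra | apply ex_RInt_const | intros; apply HPB].
    - rewrite RInt_const; unfold scal; simpl; unfold mult; simpl; ring. }
  assert (C1 : forall F : R -> R, (forall a b, - PI <= a -> a <= b -> b <= PI -> ex_RInt F a b) ->
    RInt F (- PI) PI = RInt F (- PI) (- r) + RInt F (- r) r + RInt F r PI).
  { intros F HF.
    rewrite <- (RInt_Chasles F (- PI) r PI) by (apply HF; lra).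
    rewrite <- (RInt_Chasles F (- PI) (- r) r) by (apply HF; lra).
    reflexivity. }
  change (RInt2 (fun x y => W x y * T x y)) with (RInt G (- PI) PI).
  rewrite (C1 G) by (intros; apply HG).
  rewrite <- (is_RInt_unique _ _ _ _ HPK), (C1 P) by exact HP'.
  assert (H5 : 0 <= delta * (2 * PI)) by (apply Rmult_le_pos; lra).
  assert (H6 := Rmult_le_compat_l _ _ _ H5 H4).
  nra.
Qed.

(** * Power spectrum of a grid function *)

Section Toeplitz.
Variables (n : nat) (v : nat -> nat -> R).

Let shift (i i' : nat) : R := IZR (Z.of_nat i' - Z.of_nat i).

(** This is |sum v_jk e^(i(xj + yk))|^2, expanded into cosines of index differences so that it pairs
    term by term with the integrals defining [afrac]. *)
Definition power_spectrum (x y : R) : R :=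
  sum1 n (fun j => sum1 n (fun k => sum1 n (fun j' => sum1 n (fun k' =>
    v j k * v j' k' * cos (x * shift j j' + y * shift k k'))))).

(** The mean of [power_spectrum] over y: orthogonality forces k' = k, which leaves the sum over k of
    the one-dimensional spectra of v(., k). *)
Definition marginal_spectrum (x : R) : R :=
  sum1 n (fun j => sum1 n (fun k => sum1 n (fun j' =>
    v j k * v j' k * cos (x * shift j j')))).

Let mass : R := sum1 n (fun j => sum1 n (fun k => v j k ^ 2)).

Lemma power_spectrum_cont2 : cont2 power_spectrum.
Proof.
  repeat (apply cont2_sum1; intros).
  apply (cont2_mult (fun _ _ => _)); [apply cont2_const | apply cont2_cos].
Qed.

(** The addition formula for the cosine turns the spectrum into A^2 + B^2, where A and B are the
    real and imaginary parts of the transform. *)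
Lemma power_spectrum_nonneg (x y : R) : 0 <= power_spectrum x y.
Proof.
  set (th := fun j k : nat => x * INR j + y * INR k).
  set (A := sum1 n (fun j => sum1 n (fun k => v j k * cos (th j k)))).
  set (B := sum1 n (fun j => sum1 n (fun k => v j k * sin (th j k)))).
  assert (Hlin : forall (p q : R) (f g : nat -> nat -> R),
    sum1 n (fun j => sum1 n (fun k => p * f j k + q * g j k))
    = p * sum1 n (fun j => sum1 n (f j)) + q * sum1 n (fun j => sum1 n (g j))).
  { intros; rewrite <- !sum1_scal, <- sum1_plus; apply sum1_ext; intros.
    now rewrite <- !sum1_scal, <- sum1_plus. }
  replace (power_spectrum x y) with (A * A + B * B); [nra|].
  unfold A at 2, B at 2; rewrite <- Hlin.
  apply sum1_ext; intros j _; apply sum1_ext; intros k _.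
  replace (A * (v j k * cos (th j k)) + B * (v j k * sin (th j k)))
    with (v j k * cos (th j k) * A + v j k * sin (th j k) * B) by ring.
  unfold A, B; rewrite <- Hlin.
  apply sum1_ext; intros j' _; apply sum1_ext; intros k' _.
  replace (x * shift j j' + y * shift k k') with (th j' k' - th j k).
  - rewrite cos_minus; ring.
  - unfold th, shift; rewrite !minus_IZR, <- !INR_IZR_INZ; ring.
Qed.

Lemma is_RInt_power_spectrum (x : R) :
  is_RInt (power_spectrum x) (- PI) PI (2 * PI * marginal_spectrum x).
Proof.
  unfold marginal_spectrum; rewrite <- sum1_scal.
  apply is_RInt_sum1; intros j Hj; rewrite <- sum1_scal.
  apply is_RInt_sum1; intros k Hk; rewrite <- sum1_scal.
  apply is_RInt_sum1; intros j' Hj'.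
  replace (2 * PI * (v j k * v j' k * cos (x * shift j j')))
    with (sum1 n (fun k' => if Z.eq_dec (Z.of_nat k' - Z.of_nat k) 0
            then v j k * v j' k' * (2 * PI * cos (x * shift j j')) else 0))
    by (rewrite sum1_delta_Z by exact Hk; ring).
  apply is_RInt_sum1; intros k' Hk'.
  replace (if Z.eq_dec _ 0 then _ else _) with
    (v j k * v j' k' * (if Z.eq_dec (Z.of_nat k' - Z.of_nat k) 0
            then 2 * PI * cos (x * shift j j') else 0)) by (destruct Z.eq_dec; ring).
  apply (is_RInt_scal (V := R_NormedModule)), is_RInt_cos_IZR.
Qed.

Lemma is_RInt_marginal_spectrum : is_RInt marginal_spectrum (- PI) PI (2 * PI * mass).
Proof.
  unfold mass; rewrite <- sum1_scal.
  apply is_RInt_sum1; intros j Hj; rewrite <- sum1_scal.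
  apply is_RInt_sum1; intros k Hk.
  replace (2 * PI * v j k ^ 2)
    with (sum1 n (fun j' => if Z.eq_dec (Z.of_nat j' - Z.of_nat j) 0
            then v j k * v j' k * (2 * PI) else 0))
    by (rewrite sum1_delta_Z by exact Hj; ring).
  apply is_RInt_sum1; intros j' Hj'.
  replace (if Z.eq_dec _ 0 then _ else _) with
    (v j k * v j' k * (if Z.eq_dec (Z.of_nat j' - Z.of_nat j) 0
            then 2 * PI * cos 0 else 0)) by (rewrite cos_0; destruct Z.eq_dec; ring).
  apply (is_RInt_scal (V := R_NormedModule)).
  apply is_RInt_ext with (fun y => cos (0 + y * IZR (Z.of_nat j' - Z.of_nat j))).
  - intros; f_equal; unfold shift; ring.
  - apply is_RInt_cos_IZR.
Qed.

(** Cauchy-Schwarz in the form v v' cos <= (v^2 + v'^2)/2; summing over the additional index counts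
    each half square n times. *)
Lemma marginal_spectrum_le (x : R) : marginal_spectrum x <= INR n * mass.
Proof.
  apply Rle_trans with (sum1 n (fun j => sum1 n (fun k => sum1 n (fun j' =>
    1 / 2 * v j k ^ 2 + 1 / 2 * v j' k ^ 2)))).
  - apply sum1_le; intros j _; apply sum1_le; intros k _; apply sum1_le; intros j' _.
    assert (Hc := COS_bound (x * shift j j')).
    set (c := cos (x * shift j j')) in *.
    (* The sum of the two products is 2 v^2 + 2 v'^2 - 4 c v v'. *)
    assert (H1 := Rmult_le_pos (1 + c) _ ltac:(lra) (pow2_ge_0 (v j k - v j' k))).
    assert (H2 := Rmult_le_pos (1 - c) _ ltac:(lra) (pow2_ge_0 (v j k + v j' k))).
    nra.
  - apply Req_le.
    rewrite (sum1_ext _ (fun j => INR n * (1 / 2) * sum1 n (fun k => v j k ^ 2) + 1 / 2 * mass)).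
    + rewrite sum1_plus, sum1_scal, sum1_const; fold mass; field.
    + intros j _.
      rewrite (sum1_ext _ (fun k => INR n * (1 / 2) * v j k ^ 2
                                  + 1 / 2 * sum1 n (fun j' => v j' k ^ 2))).
      * rewrite sum1_plus, !sum1_scal, (sum1_swap (fun k j' => v j' k ^ 2)); reflexivity.
      * intros k _; rewrite sum1_plus, !sum1_scal, sum1_const; ring.
Qed.
End Toeplitz.

(** * The symbol of the fractional difference and its coercivity *)

Definition symbol (beta x y : R) : R :=
  rpow (4 * sin (x / 2) ^ 2 + 4 * sin (y / 2) ^ 2) (beta / 2).

Lemma symbol_cont2 (beta : R) : 0 < beta -> cont2 (symbol beta).
Proof.
  intros Hb x y.
  apply (continuity_1d_2d_pt_comp (fun t => rpow t (beta / 2))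
    (fun x y => 4 * sin (x / 2) ^ 2 + 4 * sin (y / 2) ^ 2)).
  - apply rpow_continuity_pt; lra.
  - assert (H : forall t, continuity_pt (fun x => 4 * sin (x / 2) ^ 2) t).
    { intros t; apply derivable_continuous_pt; reg. }
    apply continuity_2d_pt_plus.
    + apply (continuity_1d_2d_pt_comp (fun x => 4 * sin (x / 2) ^ 2) (fun x y => x));
        [apply H | apply continuity_2d_pt_id1].
    + apply (continuity_1d_2d_pt_comp (fun x => 4 * sin (x / 2) ^ 2) (fun x y => y));
        [apply H | apply continuity_2d_pt_id2].
Qed.

(** Parseval's identity: [afrac] is replaced by its defining integral, and the finite sums pass
    under the integral because each term is jointly continuous. *)
Lemma quadratic_form_afrac (beta : R) (n : nat) (v : nat -> nat -> R) :
  0 < beta ->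
  sum1 n (fun j => sum1 n (fun k => v j k * sum1 n (fun j' => sum1 n (fun k' =>
    afrac beta (Z.of_nat j' - Z.of_nat j) (Z.of_nat k' - Z.of_nat k) * v j' k'))))
  = / (4 * PI ^ 2) * RInt2 (fun x y => symbol beta x y * power_spectrum n v x y).
Proof.
  intros Hb; assert (Hs := symbol_cont2 beta Hb).
  pose (cs := fun j k j' k' x y => symbol beta x y *
    cos (x * IZR (Z.of_nat j' - Z.of_nat j) + y * IZR (Z.of_nat k' - Z.of_nat k))).
  assert (Hcs : forall j k j' k', cont2 (cs j k j' k')).
  { intros; apply cont2_mult; [exact Hs | apply cont2_cos]. }
  assert (Hc : forall j k j' k', cont2 (fun x y => v j k * v j' k' * cs j k j' k' x y)).
  { intros; apply (cont2_mult (fun _ _ => _)); [apply cont2_const | apply Hcs]. }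
  rewrite (RInt2_ext _ (fun x y => sum1 n (fun j => sum1 n (fun k => sum1 n (fun j' =>
    sum1 n (fun k' => v j k * v j' k' * cs j k j' k' x y)))))).
  2:{ intros x y; unfold power_spectrum; rewrite <- sum1_scal; apply sum1_ext; intros j _.
      rewrite <- sum1_scal; apply sum1_ext; intros k _.
      rewrite <- sum1_scal; apply sum1_ext; intros j' _.
      rewrite <- sum1_scal; apply sum1_ext; intros k' _; unfold cs; ring. }
  rewrite RInt2_sum1 by (intros; repeat (apply cont2_sum1; intros); apply Hc).
  rewrite <- sum1_scal; apply sum1_ext; intros j _.
  rewrite RInt2_sum1 by (intros; repeat (apply cont2_sum1; intros); apply Hc).
  rewrite <- sum1_scal; apply sum1_ext; intros k _.
  rewrite RInt2_sum1 by (intros; repeat (apply cont2_sum1; intros); apply Hc).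
  rewrite <- !sum1_scal; apply sum1_ext; intros j' _.
  rewrite RInt2_sum1 by (intros; apply Hc).
  rewrite <- !sum1_scal; apply sum1_ext; intros k' _.
  rewrite RInt2_scal by apply Hcs.
  unfold afrac, cs, RInt2, symbol; ring.
Qed.

Lemma half_le_sin (y : R) : 0 <= y <= 1 -> y / 2 <= sin y.
Proof.
  (* The first truncation of the alternating series: sin y >= y - y^3/6. *)
  intros Hy; destruct (pre_sin_bound y 0 ltac:(lra) ltac:(lra)) as [H _].
  unfold sin_approx, sin_term in H; simpl in H; nra.
Qed.

(** The x part alone suffices: the sine increases up to pi/2, hence sin(|x|/2) >= sin(2 rho) >=
    rho. *)
Lemma symbol_lower_bound (beta x y rho : R) :
  0 < beta -> 0 < rho <= 1 / 2 -> 4 * rho <= Rabs x <= PI ->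
  Rpower rho beta <= symbol beta x y.
Proof.
  intros Hb Hr Hx; unfold symbol.
  assert (HPI := PI_RGT_0).
  assert (Hs : 4 * sin (x / 2) ^ 2 = 4 * sin (Rabs x / 2) ^ 2).
  { unfold Rabs; destruct (Rcase_abs x); [|reflexivity].
    replace (- x / 2) with (- (x / 2)) by field; rewrite sin_neg; ring. }
  assert (H1 : rho <= sin (2 * rho)).
  { replace rho with (2 * rho / 2) at 1 by field; apply half_le_sin; lra. }
  assert (H2 : sin (2 * rho) <= sin (Rabs x / 2)) by (apply sin_incr_1; lra).
  assert (H3 : rho ^ 2 <= 4 * sin (x / 2) ^ 2 + 4 * sin (y / 2) ^ 2).
  { rewrite Hs; generalize (pow2_ge_0 (sin (y / 2))); nra. }
  rewrite rpow_pos_eq by nra.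
  replace (Rpower rho beta) with (Rpower (rho ^ 2) (beta / 2)).
  - apply Rle_Rpower_l; [lra | split; [nra | exact H3]].
  - rewrite <- (Rpower_pow 2) by lra; rewrite Rpower_mult; f_equal; simpl; field.
Qed.

(** The factor 1/2 is the share of the spectral mass kept outside the strip, and (8L)^(-beta) is the
    product of h^(-beta) with the minimum (4M)^(-beta) guaranteed for the symbol there. *)
Lemma fracLap_coercive (beta L : R) (M : nat) (v : nat -> nat -> R) :
  0 < beta -> 0 < L -> (1 <= M)%nat ->
  1 / 2 * Rpower (8 * L) (- beta)
    * sum1 (M - 1) (fun j => sum1 (M - 1) (fun k => v j k ^ 2))
  <= sum1 (M - 1) (fun j => sum1 (M - 1) (fun k => v j k * fracLap beta L M v j k)).
Proof.
  intros Hb HL HM.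
  set (n := (M - 1)%nat).
  set (mass := sum1 n (fun j => sum1 n (fun k => v j k ^ 2))).
  assert (Hmass : 0 <= mass).
  { apply sum1_nonneg; intros; apply sum1_nonneg; intros; apply pow2_ge_0. }
  assert (HM0 : 1 <= INR M) by (change 1 with (INR 1); now apply le_INR).
  assert (HnM : INR n <= INR M) by (apply le_INR; unfold n; lia).
  assert (Hh : 0 < hstep L M) by (unfold hstep; apply Rdiv_lt_0_compat; lra).
  assert (HPI := PI_RGT_0).
  rewrite (sum1_ext _ (fun j => rpow (hstep L M) (- beta) * sum1 n (fun k => v j k *
    sum1 n (fun j' => sum1 n (fun k' =>
      afrac beta (Z.of_nat j' - Z.of_nat j) (Z.of_nat k' - Z.of_nat k) * v j' k'))))).
  2:{ intros j _; rewrite <- sum1_scal; apply sum1_ext; intros k _.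
      unfold fracLap; fold n; unfold sum1; ring. }
  rewrite sum1_scal, quadratic_form_afrac, rpow_pos_eq by assumption.
  (* The strip is |x| < 4 rho = 1/M. *)
  set (rho := / (4 * INR M)).
  assert (Hrho : 0 < rho <= 1 / 4).
  { unfold rho; split; [apply Rinv_0_lt_compat; lra|].
    replace (1 / 4) with (/ 4) by field; apply Rinv_le_contravar; lra. }
  assert (Hrho' : 4 * rho * INR M = 1) by (unfold rho; field; lra).
  assert (H := RInt2_lower_bound (symbol beta) (power_spectrum n v) (marginal_spectrum n v)
    (Rpower rho beta) (4 * rho) (INR n * mass) (2 * PI * mass)
    (symbol_cont2 beta Hb) (power_spectrum_cont2 n v) ltac:(generalize PI2_1; lra)
    (Rlt_le _ _ (Rpower_pos _ _)) (fun x y => rpow_nonneg _ _) (power_spectrum_nonneg n v)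
    (fun x y Hx => symbol_lower_bound beta x y rho Hb ltac:(lra) Hx)
    (is_RInt_power_spectrum n v) (marginal_spectrum_le n v) (is_RInt_marginal_spectrum n v)).
  (* The strip holds at most 2 n/M <= 2 <= pi times [mass], that is, at most half of 2 pi [mass]. *)
  assert (H1 : PI * mass <= 2 * PI * mass - 2 * (4 * rho) * (INR n * mass)).
  { assert (H1 := PI2_1).
    assert (H2 : 4 * rho * INR n <= 1) by (rewrite <- Hrho'; apply Rmult_le_compat_l; lra).
    assert (H3 := Rmult_le_compat_r mass _ _ Hmass H2).
    assert (H4 := Rmult_le_compat_r mass 2 PI Hmass ltac:(lra)).
    nra. }
  (* M cancels here, since 4 M h = 8 L. *)
  assert (H2 : Rpower (hstep L M) (- beta) * Rpower rho beta = Rpower (8 * L) (- beta)).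
  { replace rho with (/ (4 * INR M)) by reflexivity.
    replace (Rpower (/ (4 * INR M)) beta) with (Rpower (4 * INR M) (- beta)).
    - rewrite Rpower_mult_distr by lra; f_equal; unfold hstep; field; lra.
    - rewrite Rpower_Ropp; unfold Rpower; rewrite ln_Rinv by lra.
      rewrite <- exp_Ropp; f_equal; ring. }
  rewrite <- H2.
  assert (Hp := Rpower_pos (hstep L M) (- beta)).
  assert (Hd := Rpower_pos rho beta).
  set (A := Rpower (hstep L M) (- beta)) in *; set (D := Rpower rho beta) in *.
  apply Rle_trans with (A * (/ (4 * PI ^ 2) * (D * (2 * PI) * (PI * mass)))).
  - apply Req_le; field; lra.
  - apply Rmult_le_compat_l; [lra|]; apply Rmult_le_compat_l.
    + left; apply Rinv_0_lt_compat; nra.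
    + eapply Rle_trans; [|exact H]; apply Rmult_le_compat_l; [|exact H1].
      apply Rmult_le_pos; lra.
Qed.

(** * Positivity of the Gamma function on (0, 2) *)

(** The value of [RInt_gen] is informative only once convergence is known. The integrals over [x, y]
    grow with the interval and are bounded, so their supremum is the improper integral, and it
    dominates the positive integral over [1, 2]. *)
Lemma Gamma_pos (s : R) : 0 < s < 2 -> 0 < Gamma s.
Proof.
  intros Hs.
  set (f := fun t => rpow t (s - 1) * exp (- t)).
  assert (Hf : forall t, 0 < t -> f t = Rpower t (s - 1) * exp (- t)).
  { intros; unfold f; now rewrite rpow_pos_eq. }
  assert (Hcf : forall t, 0 < t -> continuous f t).
  { intros t Ht; apply continuity_pt_filterlim.
    apply continuity_pt_ext_loc with (fun t => Rpower t (s - 1) * exp (- t)).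
    - exists (mkposreal t Ht); intros u Hu.
      change (Rabs (u - t) < t) in Hu; apply Rabs_def2 in Hu; symmetry; apply Hf; lra.
    - apply continuity_pt_mult; [now apply Rpower_continuity_pt|].
      apply derivable_continuous_pt; reg. }
  assert (Hex : forall x y, 0 < x -> 0 < y -> ex_RInt f x y).
  { intros x y Hx Hy; apply (ex_RInt_continuous f); intros t Ht; apply Hcf.
    eapply Rlt_le_trans; [|apply Ht]; now apply Rmin_glb_lt. }
  (* Primitive of an explicit majorant: H' exceeds the integrand by (1 + t^2 - t^s) e^(-t)/s, which
     is nonnegative because s < 2. The term t^s/s removes the singularity at 0. *)
  set (H := fun t => (Rpower t s - t ^ 2 - 2 * t - 3) * exp (- t) / s).
  set (H' := fun t => f t + (1 + t ^ 2 - Rpower t s) * exp (- t) / s).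
  assert (HH : forall t, 0 < t -> is_derive H t (H' t)).
  { intros t Ht; unfold H, H'; rewrite Hf by exact Ht.
    replace (Rpower t (s - 1)) with (Rpower t s / t).
    2:{ unfold Rminus; rewrite Rpower_plus, Rpower_Ropp, Rpower_1 by exact Ht; reflexivity. }
    unfold Rpower; auto_derive; [exact Ht|]; field; lra. }
  assert (HcH : forall t, 0 < t -> continuous H' t).
  { intros t Ht; apply (continuous_plus f); [now apply Hcf|].
    apply continuity_pt_filterlim; unfold Rdiv.
    apply continuity_pt_mult; [apply continuity_pt_mult|].
    - apply continuity_pt_minus; [|now apply Rpower_continuity_pt].
      apply derivable_continuous_pt; reg.
    - apply derivable_continuous_pt; reg.
    - apply continuity_pt_const; intros ? ?; reflexivity. }
  assert (Hpow : forall t, 0 < t -> Rpower t s <= 1 + t ^ 2).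
  { intros t Ht; destruct (Rle_lt_dec t 1).
    - apply Rle_trans with (Rpower 1 s); [apply Rle_Rpower_l; lra|].
      unfold Rpower; rewrite ln_1, Rmult_0_r, exp_0; nra.
    - apply Rle_trans with (Rpower t (INR 2)); [left; apply Rpower_lt; simpl; lra|].
      rewrite Rpower_pow by exact Ht; lra. }
  (* H(y) <= 0, and -H(x) <= (x^2 + 2x + 3) e^(-x)/s <= 6/s for x <= 1. *)
  assert (Hbound : forall x y, 0 < x <= 1 -> 1 <= y -> RInt f x y <= 6 / s).
  { intros x y Hx Hy.
    assert (HI : is_RInt H' x y (H y - H x)).
    { apply (is_RInt_derive H H' x y); intros t Ht; [apply HH | apply HcH];
        rewrite Rmin_left in Ht by lra; lra. }
    apply Rle_trans with (RInt H' x y).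
    - apply RInt_le; [lra | apply Hex; lra | now exists (H y - H x) |].
      intros t Ht; unfold H'; assert (Hp := Hpow t ltac:(lra)).
      assert (He := exp_pos (- t)).
      assert (0 <= (1 + t ^ 2 - Rpower t s) * exp (- t) / s)
        by (apply Rdiv_le_0_compat; [apply Rmult_le_pos|]; lra).
      lra.
    - rewrite (is_RInt_unique _ _ _ _ HI); unfold H.
      assert (Hp := Hpow y ltac:(lra)); assert (Hq := Rpower_pos x s).
      assert (He := exp_pos (- y)); assert (He' := exp_pos (- x)).
      assert (He1 : exp (- x) <= 1).
      { rewrite <- exp_0; destruct (Req_dec x 0); [lra|]; left; apply exp_increasing; lra. }
      unfold Rdiv; rewrite <- Rmult_minus_distr_r.
      apply Rmult_le_compat_r; [left; apply Rinv_0_lt_compat; lra|].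
      assert ((Rpower y s - y ^ 2 - 2 * y - 3) * exp (- y) <= 0) by nra.
      assert ((x ^ 2 + 2 * x + 3 - Rpower x s) * exp (- x) <= 6 * 1).
      { apply Rle_trans with (6 * exp (- x)); [|lra].
        apply Rmult_le_compat_r; [lra | nra]. }
      lra. }
  assert (Hfpos : forall t, 0 < t -> 0 < f t).
  { intros t Ht; rewrite Hf by exact Ht; apply Rmult_lt_0_compat; apply exp_pos. }
  assert (Hmono : forall x y x0 y0, 0 < x <= x0 -> x0 <= 1 -> 1 <= y0 <= y ->
    RInt f x0 y0 <= RInt f x y).
  { intros x y x0 y0 Hx Hx0 Hy.
    rewrite <- (RInt_Chasles f x x0 y) by (apply Hex; lra).
    rewrite <- (RInt_Chasles f x0 y0 y) by (apply Hex; lra).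
    assert (0 <= RInt f x x0)
      by (apply RInt_ge_0; [lra | apply Hex; lra | intros; left; apply Hfpos; lra]).
    assert (0 <= RInt f y0 y)
      by (apply RInt_ge_0; [lra | apply Hex; lra | intros; left; apply Hfpos; lra]).
    unfold plus; simpl; lra. }
  destruct (completeness (fun I => exists x y, 0 < x <= 1 /\ 1 <= y /\ I = RInt f x y))
    as [l [Hub Hlub]].
  - exists (6 / s); intros I [x [y [Hx [Hy ->]]]]; now apply Hbound.
  - exists (RInt f 1 1), 1, 1; repeat split; lra.
  - assert (Hl : is_RInt_gen f (at_right 0) (Rbar_locally p_infty) l).
    { intros P [eps HP].
      (* Some interval comes within eps of the supremum; by [Hmono] all larger ones do too. *)
      assert (Hx0 : exists x0 y0, 0 < x0 <= 1 /\ 1 <= y0 /\ l - eps < RInt f x0 y0).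
      { apply Classical_Prop.NNPP; intros Hn.
        assert (l <= l - eps); [|generalize (cond_pos eps); lra].
        apply Hlub; intros I [x [y [Hx [Hy ->]]]].
        apply Rnot_lt_le; intros Hlt; apply Hn; now exists x, y. }
      destruct Hx0 as [x0 [y0 [Hx0 [Hy0 Hlt]]]].
      apply Filter_prod with (fun x => 0 < x <= x0) (fun y => y0 <= y).
      - exists (mkposreal x0 (proj1 Hx0)); intros x Hx Hpos.
        change (Rabs (x - 0) < x0) in Hx; apply Rabs_def2 in Hx; lra.
      - exists y0; intros; lra.
      - intros x y Hx Hy; exists (RInt f x y); split; simpl.
        + apply (RInt_correct f), Hex; lra.
        + apply HP; change (Rabs (RInt f x y - l) < eps).
          assert (H1 := Hmono x y x0 y0 Hx (proj2 Hx0) (conj Hy0 Hy)).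
          assert (H2 : RInt f x y <= l) by (apply Hub; exists x, y; repeat split; lra).
          apply Rabs_def1; generalize (cond_pos eps); lra. }
    unfold Gamma; change (fun t => rpow t (s - 1) * exp (- t)) with f.
    rewrite (is_RInt_gen_unique _ _ Hl).
    apply Rlt_le_trans with (RInt f 1 2).
    + apply RInt_gt_0; [lra | intros; apply Hfpos; lra | intros; apply Hcf; lra].
    + apply Hub; exists 1, 2; repeat split; lra.
Qed.

(** * Calculus of the power kernel *)

(** Most inequalities below reduce to the monotonicity of an explicit auxiliary function. *)
Lemma nonneg_derive_le (f df : R -> R) (a b : R) :
  a <= b -> (forall x, a <= x <= b -> is_derive f x (df x)) ->
  (forall x, a <= x <= b -> 0 <= df x) -> f a <= f b.
Proof.
  intros Hab Hd Hpos.
  destruct (MVT_gen f a b df) as [c [Hc E]].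
  - intros x Hx; rewrite Rmin_left, Rmax_right in Hx by lra; apply Hd; lra.
  - intros x Hx; rewrite Rmin_left, Rmax_right in Hx by lra.
    apply derivable_continuous_pt, ex_derive_Reals_0; exists (df x); now apply Hd.
  - rewrite Rmin_left, Rmax_right in Hc by lra; specialize (Hpos c Hc).
    assert (0 <= df c * (b - a)) by (apply Rmult_le_pos; lra); lra.
Qed.

Lemma Rpower_succ (x y : R) : 0 < x -> Rpower x (y + 1) = Rpower x y * x.
Proof. intros Hx; now rewrite Rpower_plus, Rpower_1. Qed.

Lemma Rpower_pred (x y : R) : 0 < x -> Rpower x (y - 1) = Rpower x y / x.
Proof.
  intros Hx; unfold Rminus; rewrite Rpower_plus, Rpower_Ropp, Rpower_1 by exact Hx; reflexivity.
Qed.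

Lemma Rpower_pred2 (x y : R) : 0 < x -> Rpower x (y - 2) = Rpower x y / x ^ 2.
Proof.
  intros Hx; replace (y - 2) with (y - 1 - 1) by ring.
  rewrite !Rpower_pred by exact Hx; field; lra.
Qed.

Lemma Rpower_anti (x y q : R) : q <= 0 -> 0 < x <= y -> Rpower y q <= Rpower x q.
Proof.
  intros Hq Hx; replace q with (- - q) by ring; rewrite (Rpower_Ropp y), (Rpower_Ropp x).
  apply Rinv_le_contravar; [apply Rpower_pos | apply Rle_Rpower_l; lra].
Qed.

Section Power.
Variable p : R.
Hypothesis Hp : 0 < p < 1.

(** Concavity of x^p: the slope of the chord lies between the slopes at its ends; the next lemma is
    the other half. *)
Lemma Rpower_tangent_right (u v : R) :
  0 < u <= v -> p * (v - u) * Rpower v (p - 1) <= Rpower v p - Rpower u p.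
Proof.
  intros Huv; assert (Hv := Rpower_pos v p).
  set (V := Rpower v (p - 1)).
  enough (Rpower u p - p * u * V <= Rpower v p - p * v * V) by lra.
  apply (nonneg_derive_le (fun x => Rpower x p - p * x * V) (fun x => p * (Rpower x (p - 1) - V)));
    [lra | |].
  - intros x Hx; rewrite Rpower_pred by lra; unfold Rpower at 1 2; auto_derive; [lra | field; lra].
  - intros x Hx; apply Rmult_le_pos; [lra|].
    assert (V <= Rpower x (p - 1)) by (apply Rpower_anti; lra); lra.
Qed.

Lemma Rpower_tangent_left (u v : R) :
  0 < u <= v -> Rpower v p - Rpower u p <= p * (v - u) * Rpower u (p - 1).
Proof.
  intros Huv.
  set (U := Rpower u (p - 1)).
  enough (p * u * U - Rpower u p <= p * v * U - Rpower v p) by lra.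
  apply (nonneg_derive_le (fun x => p * x * U - Rpower x p) (fun x => p * (U - Rpower x (p - 1))));
    [lra | |].
  - intros x Hx; rewrite Rpower_pred by lra; unfold Rpower at 1 2; auto_derive; [lra | field; lra].
  - intros x Hx; apply Rmult_le_pos; [lra|].
    assert (Rpower x (p - 1) <= U) by (apply Rpower_anti; lra); lra.
Qed.

(* Twice the error of the trapezoidal rule for the integral of [x^p] over [[u, v]]. *)
Definition trap (u v : R) : R :=
  2 / (p + 1) * (Rpower v (p + 1) - Rpower u (p + 1)) - (v - u) * (Rpower u p + Rpower v p).

(** The derivative is the gap in the tangent inequality at v, so bounds on this gap integrate to
    bounds on [trap]. *)
Lemma is_derive_trap (u v : R) :
  0 < u -> 0 < v ->
  is_derive (trap u) v (Rpower v p - Rpower u p - p * (v - u) * Rpower v (p - 1)).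
Proof.
  intros Hu Hv; rewrite Rpower_pred by exact Hv.
  assert (E : Rpower v (p + 1) = Rpower v p * v) by now apply Rpower_succ.
  unfold trap; unfold Rpower in *; auto_derive; [lra|]; rewrite E; field; lra.
Qed.

Lemma trap_diag (u : R) : trap u u = 0.
Proof. unfold trap; ring. Qed.

Lemma trap_nonneg (u v : R) : 0 < u <= v -> 0 <= trap u v.
Proof.
  intros Huv; rewrite <- (trap_diag u).
  apply (nonneg_derive_le (trap u)
    (fun v => Rpower v p - Rpower u p - p * (v - u) * Rpower v (p - 1))); [lra | |].
  - intros; apply is_derive_trap; lra.
  - intros x Hx; assert (H := Rpower_tangent_right u x ltac:(lra)); lra.
Qed.

(** The left end moves here, because the bound involves the slope at v; the derivative is twice the
    tangent gap on [x, v]. *)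
Lemma trap_le_tangent (u v : R) :
  0 < u <= v ->
  trap u v <= (v - u) * (Rpower v p - Rpower u p - p * (v - u) * Rpower v (p - 1)).
Proof.
  intros Huv.
  set (V := Rpower v (p - 1)); set (W := Rpower v p).
  set (g := fun x => 2 / (p + 1) * (Rpower v (p + 1) - Rpower x (p + 1))
                     - 2 * (v - x) * W + p * (v - x) ^ 2 * V).
  enough (g u <= g v) by (unfold g, trap in *; fold W; nra).
  apply (nonneg_derive_le g (fun x => 2 * (W - Rpower x p - p * (v - x) * V))); [lra | |].
  - intros x Hx; unfold g.
    assert (E : Rpower x (p + 1) = Rpower x p * x) by (apply Rpower_succ; lra).
    unfold Rpower in E |- * at 2 3; auto_derive; [lra|]; rewrite E; field; lra.
  - intros x Hx; assert (H := Rpower_tangent_right x v ltac:(lra)); fold V W in H; lra.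
Qed.

(** Twice the classical trapezoidal error (v - u)^3/12 times the maximum of |f''|; for f = x^p that
    maximum p(1-p)u^(p-2) sits at the left end. *)
Lemma trap_le_cube (u v : R) :
  0 < u <= v -> trap u v <= p * (1 - p) / 6 * Rpower u (p - 2) * (v - u) ^ 3.
Proof.
  intros Huv.
  set (U := Rpower u (p - 2)).
  assert (HU : forall x, u <= x -> Rpower x (p - 2) <= U)
    by (intros; apply Rpower_anti; lra).
  set (g := fun x => p * (1 - p) / 2 * U * (x - u) ^ 2
                     - (Rpower x p - Rpower u p - p * (x - u) * Rpower x (p - 1))).
  assert (Hg : forall x, u <= x -> 0 <= g x).
  { intros x Hx; replace 0 with (g u) by (unfold g; ring).
    apply (nonneg_derive_le g (fun x => p * (1 - p) * (x - u) * (U - Rpower x (p - 2)))); [lra | |].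
    - intros y Hy; unfold g; rewrite Rpower_pred2 by lra.
      assert (E : Rpower y (p - 1) = Rpower y p / y) by (apply Rpower_pred; lra).
      unfold Rpower in E |- * at 1 3 4; auto_derive; [lra|]; rewrite E; field; lra.
    - intros y Hy; specialize (HU y ltac:(lra)).
      apply Rmult_le_pos; [apply Rmult_le_pos; [apply Rmult_le_pos|]|]; lra. }
  set (h := fun x => p * (1 - p) / 6 * U * (x - u) ^ 3 - trap u x).
  enough (h u <= h v) by (unfold h in *; rewrite trap_diag in *; nra).
  apply (nonneg_derive_le h g); [lra | |].
  - intros x Hx; unfold h, g.
    apply (is_derive_minus (V := R_NormedModule)); [|apply is_derive_trap; lra].
    auto_derive; [trivial | field].
  - intros x Hx; apply Hg; lra.
Qed.

(** Second-order Taylor remainder at w, with |f''| bounded below by its value at u. The factor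
    u^(p-2) is the one in [trap_le_cube], which makes the two bounds comparable. *)
Lemma Rpower_tangent_gap (w u : R) :
  0 < w <= u ->
  1 / 2 * (u - w) ^ 2 * (p * (1 - p)) * Rpower u (p - 2)
  <= p * (u - w) * Rpower w (p - 1) - (Rpower u p - Rpower w p).
Proof.
  intros Hwu.
  set (U := Rpower u (p - 2)); set (V := Rpower u p).
  set (g := fun x => 1 / 2 * (u - x) ^ 2 * (p * (1 - p)) * U
                     - p * (u - x) * Rpower x (p - 1) + (V - Rpower x p)).
  enough (g w <= g u) by (unfold g, V in *; nra).
  apply (nonneg_derive_le g (fun x => p * (1 - p) * (u - x) * (Rpower x (p - 2) - U))); [lra | |].
  - intros x Hx; unfold g; rewrite Rpower_pred2 by lra.
    assert (E : Rpower x (p - 1) = Rpower x p / x) by (apply Rpower_pred; lra).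
    unfold Rpower in E |- * at 1 2 3; auto_derive; [lra|]; rewrite E; field; lra.
  - intros x Hx; assert (U <= Rpower x (p - 2)) by (apply Rpower_anti; lra).
    apply Rmult_le_pos; [apply Rmult_le_pos; [apply Rmult_le_pos|]|]; lra.
Qed.

(* The only place where comparing inner weights uses the step ratio: at most 2 suffices. *)
Lemma trap_absorbed (u v s : R) :
  0 < s < u -> 0 < v - u <= 2 * s ->
  / ((v - u) + s) * trap u v
  <= p * s * Rpower (u - s) (p - 1) - (Rpower u p - Rpower (u - s) p).
Proof.
  intros Hs Hv.
  assert (H1 := trap_le_cube u v ltac:(lra)).
  assert (H2 := Rpower_tangent_gap (u - s) u ltac:(lra)).
  replace (u - (u - s)) with s in H2 by ring.
  eapply Rle_trans; [|exact H2].
  apply Rmult_le_reg_l with ((v - u) + s); [lra|].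
  rewrite <- Rmult_assoc, Rinv_r, Rmult_1_l by lra.
  eapply Rle_trans; [exact H1|].
  assert (HU := Rpower_pos u (p - 2)).
  set (U := Rpower u (p - 2)) in *; set (r := v - u) in *.
  assert (HK : 0 <= p * (1 - p) * U) by (apply Rmult_le_pos; [apply Rmult_le_pos|]; lra).
  (* After the common factor p(1-p)u^(p-2) is removed, r^3/6 <= s^2 (r + s)/2 remains, which follows
     from r <= 2s. *)
  assert (HS : r ^ 3 <= 3 * s ^ 2 * (r + s)).
  { assert (r ^ 2 <= 4 * s ^ 2) by nra.
    assert (r ^ 3 <= 4 * s ^ 2 * r) by nra.
    assert (s ^ 2 * r <= 2 * s ^ 3) by nra.
    nra. }
  assert (H3 := Rmult_le_compat_l _ _ _ HK HS); lra.
Qed.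
End Power.

(* The coefficient b of the paper for the step [[u, v]], measured backwards from the
   evaluation point, when [s] is the length of the next step. *)
Definition quad_weight (p u v s : R) : R := / ((v - u) + s) * trap p u v.

Lemma quad_weight_nonneg (p u v s : R) :
  0 < p < 1 -> 0 < u < v -> 0 < s -> 0 <= quad_weight p u v s.
Proof.
  intros Hp Huv Hs; apply Rmult_le_pos; [left; apply Rinv_0_lt_compat; lra|].
  apply trap_nonneg; lra.
Qed.

(** The fraction (v - u)/((v - u) + s) is below 1. Consequently a - b keeps at least the tangent
    term p (v - u) v^(p-1). *)
Lemma quad_weight_le_tangent (p u v s : R) :
  0 < p < 1 -> 0 < u < v -> 0 < s ->
  quad_weight p u v s <= Rpower v p - Rpower u p - p * (v - u) * Rpower v (p - 1).
Proof.
  intros Hp Huv Hs; apply Rmult_le_reg_l with ((v - u) + s); [lra|].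
  unfold quad_weight; rewrite <- Rmult_assoc, Rinv_r, Rmult_1_l by lra.
  eapply Rle_trans; [apply trap_le_tangent; lra|].
  apply Rmult_le_compat_r; [|lra].
  assert (H := Rpower_tangent_right p Hp u v ltac:(lra)); lra.
Qed.

Lemma quad_weight_scale (p q u v s : R) :
  0 < q -> 0 < u < v -> 0 < s ->
  quad_weight p (q * u) (q * v) (q * s) = Rpower q p * quad_weight p u v s.
Proof.
  intros Hq Huv Hs; unfold quad_weight, trap.
  rewrite <- !Rpower_mult_distr, !(Rpower_succ q) by lra.
  replace (q * v - q * u + q * s) with (q * (v - u + s)) by ring.
  rewrite Rinv_mult; set (i := / (v - u + s)).
  unfold Rdiv; set (j := / (p + 1)); field; lra.
Qed.

(** The continuous extension of ln(1 + cq)/q to q = 0, the limit in which the logarithmic mesh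
    becomes uniform. *)
Definition log_quotient (c q : R) : R := if Req_dec_T q 0 then c else ln (1 + c * q) / q.

Lemma log_quotient_0 (c : R) : log_quotient c 0 = c.
Proof. unfold log_quotient; destruct (Req_dec_T 0 0); [reflexivity | lra]. Qed.

Lemma mult_log_quotient (c q : R) : q <> 0 -> q * log_quotient c q = ln (1 + c * q).
Proof. intros Hq; unfold log_quotient; destruct (Req_dec_T q 0); [lra | now field]. Qed.

Lemma log_quotient_continuity (c : R) : continuity_pt (log_quotient c) 0.
Proof.
  assert (H : is_derive (fun x => ln (1 + c * x)) 0 c) by (auto_derive; [lra | field; lra]).
  apply is_derive_Reals in H.
  apply continuity_pt_locally; intros eps.
  destruct (H eps (cond_pos eps)) as [d Hd]; exists d; intros q Hq.
  change (Rabs (q - 0) < d) in Hq; rewrite Rminus_0_r in Hq.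
  rewrite log_quotient_0; unfold log_quotient; destruct (Req_dec_T q 0) as [->|Hq0].
  - rewrite Rminus_diag, Rabs_R0; apply cond_pos.
  - specialize (Hd q Hq0 Hq); rewrite Rplus_0_l, Rmult_0_r, Rplus_0_r, ln_1 in Hd.
    now rewrite Rminus_0_r in Hd.
Qed.

(* Up to positive factors, [p c_(k+1,k) - s^2 c_(k,k)], where [d0], [d1], [d2] are the log
   distances to t_k, t_(k-1), t_(k-2), and [s1], [s0] the steps after and before t_k. *)
Definition last_gap (p s d0 d1 d2 s1 s0 : R) : R :=
  p * (Rpower d0 p + quad_weight p d0 d1 s1) * s0
  - s ^ 2 * (Rpower d1 p - Rpower d0 p + quad_weight p d1 d2 s0 - quad_weight p d0 d1 s1) * s1.

(* On a uniform mesh, with [s = (1 + p) / 2], the powers combine so that only the strict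
   inequality [2 s^2 < 1 + s] is needed. *)
Lemma last_gap_uniform_pos (s : R) :
  1 / 2 < s < 1 -> 0 < last_gap (2 * s - 1) s s (s + 1) (s + 2) 1 1.
Proof.
  intros Hs; set (p := 2 * s - 1).
  assert (Hp : 0 < p < 1) by (unfold p; lra).
  assert (HX := Rpower_pos (s + 1) p).
  assert (HZ := Rpower_tangent_left p Hp (s + 1) (s + 2) ltac:(lra)).
  rewrite Rpower_pred in HZ by lra.
  unfold last_gap, quad_weight, trap; rewrite !Rpower_succ by lra.
  set (X := Rpower (s + 1) p) in *; set (Y := Rpower s p); set (Z := Rpower (s + 2) p) in *.
  (* As 2/(p+1) = 1/s, the powers of s cancel: the last weight becomes X/(2s) and the previous one
     (Z - X)/s. *)
  replace (p + 1) with (2 * s) by (unfold p; ring).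
  apply Rlt_le_trans with (p * X * (/ (2 * s) - s / (s + 1))).
  - apply Rmult_lt_0_compat; [nra|].
    replace (/ (2 * s) - s / (s + 1)) with ((1 + s - 2 * s ^ 2) / (2 * s * (s + 1)))
      by (field; lra).
    apply Rdiv_lt_0_compat; nra.
  - apply Rle_trans with (p * X * / (2 * s) - s * (Z - X)).
    + assert (s * (Z - X) <= s * (p * (s + 2 - (s + 1)) * (X / (s + 1))))
        by (apply Rmult_le_compat_l; lra).
      replace (p * X * (/ (2 * s) - s / (s + 1))) with
        (p * X * / (2 * s) - s * (p * (s + 2 - (s + 1)) * (X / (s + 1)))) by (field; lra).
      lra.
    + apply Req_le; field; lra.
Qed.

Lemma continuity_pt_Rpower_comp (f : R -> R) (y x : R) :
  continuity_pt f x -> 0 < f x -> continuity_pt (fun t => Rpower (f t) y) x.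
Proof.
  intros Hf Hx; apply (continuity_pt_comp f (fun t => Rpower t y)); [exact Hf|].
  now apply Rpower_continuity_pt.
Qed.

Lemma quad_weight_continuity (p : R) (u v s : R -> R) (x : R) :
  continuity_pt u x -> continuity_pt v x -> continuity_pt s x ->
  0 < u x < v x -> 0 < s x ->
  continuity_pt (fun t => quad_weight p (u t) (v t) (s t)) x.
Proof.
  intros Hu Hv Hs Huv Hs0; unfold quad_weight, trap.
  assert (Hc : forall c : R, continuity_pt (fun _ => c) x)
    by (intros; apply continuity_pt_const; intros ? ?; reflexivity).
  repeat first
    [ assumption
    | apply Hc
    | apply (continuity_pt_mult (fun t => / (v t - u t + s t)))
    | apply (continuity_pt_inv (fun t => v t - u t + s t))
    | apply (continuity_pt_minus (fun t =>
        2 / (p + 1) * (Rpower (v t) (p + 1) - Rpower (u t) (p + 1))))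
    | apply (continuity_pt_mult (fun _ => 2 / (p + 1)))
    | apply (continuity_pt_mult (fun t => v t - u t))
    | apply (continuity_pt_plus (fun t => v t - u t) s)
    | apply (continuity_pt_minus (fun t => Rpower (v t) (p + 1)))
    | apply (continuity_pt_plus (fun t => Rpower (u t) p))
    | apply (continuity_pt_minus v u)
    | apply continuity_pt_Rpower_comp
    | lra ].
Qed.

(** Divided by q, all distances extend continuously to q = 0 with the values of the uniform mesh,
    where the gap is positive. Continuity gives delta, and homogeneity restores the true
    distances. *)
Lemma last_gap_pos_eventually (s : R) :
  1 / 2 < s < 1 ->
  exists delta, 0 < delta /\ forall q, 0 < q < delta -> q < 1 / 2 ->
    0 < last_gap (2 * s - 1) s (ln (1 + s * q)) (ln (1 + s * q) - ln (1 - q))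
         (ln (1 + s * q) - ln (1 - 2 * q)) (ln (1 + q)) (- ln (1 - q)).
Proof.
  intros Hs; set (p := 2 * s - 1).
  (* The parameters s, -1, -2, 1 are the positions of t_(k+sigma), t_(k-1), t_(k-2), t_(k+1)
     relative to t_k, in units of tau. *)
  pose (d0 := log_quotient s).
  pose (d1 := fun q => log_quotient s q - log_quotient (-1) q).
  pose (d2 := fun q => log_quotient s q - log_quotient (-2) q).
  pose (s1 := log_quotient 1).
  pose (s0 := fun q => - log_quotient (-1) q).
  assert (E : d0 0 = s /\ d1 0 = s + 1 /\ d2 0 = s + 2 /\ s1 0 = 1 /\ s0 0 = 1).
  { unfold d0, d1, d2, s1, s0; rewrite !log_quotient_0; repeat split; ring. }
  destruct E as [E0 [E1 [E2 [E3 E4]]]].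
  assert (C0 : continuity_pt d0 0) by apply log_quotient_continuity.
  assert (C1 : continuity_pt d1 0)
    by (apply continuity_pt_minus; apply log_quotient_continuity).
  assert (C2 : continuity_pt d2 0)
    by (apply continuity_pt_minus; apply log_quotient_continuity).
  assert (C3 : continuity_pt s1 0) by apply log_quotient_continuity.
  assert (C4 : continuity_pt s0 0) by (apply continuity_pt_opp; apply log_quotient_continuity).
  assert (Hc : forall c : R, continuity_pt (fun _ => c) 0)
    by (intros; apply continuity_pt_const; intros ? ?; reflexivity).
  assert (W1 : continuity_pt (fun t => quad_weight p (d0 t) (d1 t) (s1 t)) 0)
    by (apply quad_weight_continuity; try assumption; lra).
  assert (W2 : continuity_pt (fun t => quad_weight p (d1 t) (d2 t) (s0 t)) 0)
    by (apply quad_weight_continuity; try assumption; lra).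
  assert (P0 : continuity_pt (fun t => Rpower (d0 t) p) 0)
    by (apply continuity_pt_Rpower_comp; [exact C0 | lra]).
  assert (P1 : continuity_pt (fun t => Rpower (d1 t) p) 0)
    by (apply continuity_pt_Rpower_comp; [exact C1 | lra]).
  assert (C : continuity_pt (fun t => last_gap p s (d0 t) (d1 t) (d2 t) (s1 t) (s0 t)) 0).
  { unfold last_gap.
    apply (continuity_pt_minus
      (fun t => p * (Rpower (d0 t) p + quad_weight p (d0 t) (d1 t) (s1 t)) * s0 t)).
    - apply (continuity_pt_mult
        (fun t => p * (Rpower (d0 t) p + quad_weight p (d0 t) (d1 t) (s1 t)))); [|exact C4].
      apply (continuity_pt_mult (fun _ => p)); [apply Hc|].
      now apply (continuity_pt_plus (fun t => Rpower (d0 t) p)).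
    - apply (continuity_pt_mult (fun t => s ^ 2 * (Rpower (d1 t) p - Rpower (d0 t) p
        + quad_weight p (d1 t) (d2 t) (s0 t) - quad_weight p (d0 t) (d1 t) (s1 t))));
        [|exact C3].
      apply (continuity_pt_mult (fun _ => s ^ 2)); [apply Hc|].
      apply (continuity_pt_minus (fun t => Rpower (d1 t) p - Rpower (d0 t) p
        + quad_weight p (d1 t) (d2 t) (s0 t))); [|exact W1].
      apply (continuity_pt_plus (fun t => Rpower (d1 t) p - Rpower (d0 t) p)); [|exact W2].
      now apply (continuity_pt_minus (fun t => Rpower (d1 t) p)). }
  assert (Hpos := last_gap_uniform_pos s Hs); fold p in Hpos.
  apply continuity_pt_locally with (eps := mkposreal _ Hpos) in C.
  destruct C as [delta Hdelta]; exists delta; split; [apply cond_pos|].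
  intros q Hq Hq2.
  specialize (Hdelta q); rewrite E0, E1, E2, E3, E4 in Hdelta; simpl in Hdelta.
  assert (Hball : ball 0 delta q).
  { change (Rabs (q - 0) < delta); rewrite Rminus_0_r, Rabs_pos_eq; lra. }
  specialize (Hdelta Hball); apply Rabs_def2 in Hdelta.
  assert (Hg : 0 < last_gap p s (d0 q) (d1 q) (d2 q) (s1 q) (s0 q)) by lra.
  assert (Hl : ln (1 - 2 * q) < ln (1 - q)) by (apply ln_increasing; lra).
  assert (Hl0 : 0 < ln (1 + s * q)) by (rewrite <- ln_1; apply ln_increasing; nra).
  assert (Hl1 : 0 < ln (1 + q)) by (rewrite <- ln_1; apply ln_increasing; lra).
  assert (Hl2 : ln (1 - q) < 0) by (rewrite <- ln_1; apply ln_increasing; lra).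
  assert (Q0 : q * d0 q = ln (1 + s * q)) by (apply mult_log_quotient; lra).
  assert (Qm1 : q * log_quotient (-1) q = ln (1 - q))
    by (rewrite mult_log_quotient by lra; f_equal; ring).
  assert (Qm2 : q * log_quotient (-2) q = ln (1 - 2 * q))
    by (rewrite mult_log_quotient by lra; f_equal; ring).
  assert (Q1 : q * d1 q = ln (1 + s * q) - ln (1 - q))
    by (rewrite <- Q0, <- Qm1; unfold d0, d1; ring).
  assert (Q2 : q * d2 q = ln (1 + s * q) - ln (1 - 2 * q))
    by (rewrite <- Q0, <- Qm2; unfold d0, d2; ring).
  assert (Q3 : q * s1 q = ln (1 + q))
    by (unfold s1; rewrite mult_log_quotient by lra; f_equal; ring).
  assert (Q4 : q * s0 q = - ln (1 - q)) by (rewrite <- Qm1; unfold s0; ring).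
  assert (Hd0 : 0 < d0 q) by (apply Rmult_lt_reg_l with q; lra).
  assert (Hd1 : d0 q < d1 q) by (apply Rmult_lt_reg_l with q; lra).
  assert (Hd2 : d1 q < d2 q) by (apply Rmult_lt_reg_l with q; lra).
  assert (Hs1 : 0 < s1 q) by (apply Rmult_lt_reg_l with q; lra).
  assert (Hs0 : 0 < s0 q) by (apply Rmult_lt_reg_l with q; lra).
  rewrite <- Q1, <- Q2, <- Q3, <- Q4, <- Q0.
  (* Homogeneity of degree p + 1: q^p from the weights and q from the step multiplying them. *)
  replace (last_gap _ _ _ _ _ _ _)
    with (Rpower q p * q * last_gap p s (d0 q) (d1 q) (d2 q) (s1 q) (s0 q)).
  - apply Rmult_lt_0_compat; [|exact Hg]; apply Rmult_lt_0_compat; [apply Rpower_pos | lra].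
  - unfold last_gap; rewrite !quad_weight_scale by lra.
    rewrite <- !Rpower_mult_distr by lra; ring.
Qed.

(** * The L2-1sigma weights on the logarithmic mesh *)

Section Mesh.
Variables (alpha a T : R) (N : nat).
Hypotheses (Halpha : 0 < alpha < 1) (Ha : 0 < a) (HT : a < T) (HN : (1 <= N)%nat).

Let p := 1 - alpha.
Let sg := sgm alpha.
Let t := tau a T N.
Let lg (x : R) := ln (tg a T N x).
(** Distances are measured backwards from t_(k+sigma): they decrease in i, so d^(p-1) increases. *)
Let d (k i : nat) := lg (INR k + sg) - lg (INR i).
Let s (i : nat) := lg (INR i) - lg (INR (i - 1)).
Let G := Gamma (2 - alpha).
Let c (i k : nat) := ccoef alpha a T N i k.

Lemma tau_pos : 0 < tau a T N.
Proof.
  unfold tau; apply Rdiv_lt_0_compat; [lra|]; apply lt_0_INR; lia.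
Qed.

Lemma tg_pos (x : R) : 0 <= x -> 0 < tg a T N x.
Proof.
  intros Hx; assert (Ht := tau_pos); unfold tg.
  assert (0 <= x * tau a T N) by (apply Rmult_le_pos; lra); lra.
Qed.

Lemma ln_tg_ratio (x y : R) : 0 <= x -> 0 <= y -> ln (tg a T N x / tg a T N y) = lg x - lg y.
Proof. intros Hx Hy; apply ln_div; now apply tg_pos. Qed.

Lemma ln_tg_lt (x y : R) : 0 <= x < y -> lg x < lg y.
Proof.
  intros Hxy; apply ln_increasing; [apply tg_pos; lra|].
  assert (Ht := tau_pos); unfold tg.
  assert (x * tau a T N < y * tau a T N) by (apply Rmult_lt_compat_r; lra); lra.
Qed.

Lemma exponent_bounds : 0 < p < 1 /\ 1 / 2 < sg < 1 /\ p = 2 * sg - 1.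
Proof. unfold p, sg, sgm; lra. Qed.

Lemma log_step_pos (i : nat) : (1 <= i)%nat -> 0 < s i.
Proof.
  intros Hi; unfold s; enough (lg (INR (i - 1)) < lg (INR i)) by lra.
  apply ln_tg_lt; split; [apply pos_INR | apply lt_INR; lia].
Qed.

Lemma log_dist_pos (k i : nat) : (i <= k)%nat -> 0 < d k i.
Proof.
  intros Hi; unfold d; enough (lg (INR i) < lg (INR k + sg)) by lra.
  apply ln_tg_lt; split; [apply pos_INR|].
  apply le_INR in Hi; assert (H := exponent_bounds); lra.
Qed.

Lemma log_dist_pred (k i : nat) : d k (i - 1) - d k i = s i.
Proof. unfold d, s; ring. Qed.

(** Exponentiated, this is t_i^3 <= t_(i+1)^2 t_(i-1). With y = t_(i-1) it reads (y + tau)^3 <= (y +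
    2 tau)^2 y, which holds once tau <= a <= y. It supplies the ratio 2 required by
    [trap_absorbed]. *)
Lemma log_step_ratio (i : nat) : (1 <= i)%nat -> t <= a -> s i <= 2 * s (i + 1).
Proof.
  intros Hi Hta; unfold s; replace (i + 1 - 1)%nat with i by lia.
  rewrite plus_INR, minus_INR by lia; simpl (INR 1).
  assert (Hi' := le_INR _ _ Hi); simpl in Hi'.
  set (x := INR i) in *.
  enough (3 * lg x <= 2 * lg (x + 1) + lg (x - 1)) by lra.
  unfold lg; assert (H0 := tg_pos x ltac:(lra)).
  assert (H1 := tg_pos (x + 1) ltac:(lra)); assert (H2 := tg_pos (x - 1) ltac:(lra)).
  replace (3 * ln (tg a T N x)) with (ln (tg a T N x ^ 3))
    by (rewrite ln_pow by assumption; simpl; ring).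
  replace (2 * ln (tg a T N (x + 1))) with (ln (tg a T N (x + 1) ^ 2))
    by (rewrite ln_pow by assumption; simpl; ring).
  rewrite <- ln_mult by (try apply pow_lt; assumption).
  apply ln_le; [now apply pow_lt|].
  assert (Ht := tau_pos); fold t in Ht.
  replace (tg a T N (x + 1)) with (tg a T N (x - 1) + 2 * t) by (unfold tg, t; ring).
  replace (tg a T N x) with (tg a T N (x - 1) + t) by (unfold tg, t; ring).
  assert (H3 : t <= tg a T N (x - 1)).
  { unfold tg; fold t; assert (0 <= (x - 1) * t) by (apply Rmult_le_pos; lra); lra. }
  set (y := tg a T N (x - 1)) in *.
  assert (t * t <= y * y) by nra; assert (t ^ 3 <= y ^ 2 * t) by nra.
  assert (0 <= y * t ^ 2) by (apply Rmult_le_pos; nra).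
  nra.
Qed.

Lemma acoef_log (k i : nat) :
  (1 <= i <= k)%nat -> acoef alpha a T N i k = Rpower (d k (i - 1)) p - Rpower (d k i) p.
Proof.
  intros Hi; assert (H := exponent_bounds); unfold acoef; fold sg.
  rewrite !ln_tg_ratio by (generalize (pos_INR k), (pos_INR i), (pos_INR (i - 1)); lra).
  rewrite !rpow_pos_eq by (apply (log_dist_pos k); lia); reflexivity.
Qed.

Lemma bcoef_log (k i : nat) :
  (1 <= i <= k)%nat ->
  bcoef alpha a T N i k = quad_weight p (d k i) (d k (i - 1)) (s (i + 1)).
Proof.
  intros Hi; assert (H := exponent_bounds); unfold bcoef; fold sg.
  rewrite !ln_tg_ratio by (generalize (pos_INR k), (pos_INR i), (pos_INR (i - 1)),
    (pos_INR (i + 1)); lra).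
  rewrite !rpow_pos_eq by (apply (log_dist_pos k); lia).
  unfold quad_weight, trap; rewrite log_dist_pred.
  replace (p + 1) with (2 - alpha) by (unfold p; ring).
  f_equal; f_equal; unfold s; replace (i + 1 - 1)%nat with i by lia; ring.
Qed.

(** Clearing denominators unites the first weight with the others, a zero standing for the missing
    b_(0,k). *)
Lemma ccoef_inner (k i : nat) :
  (1 <= i <= k)%nat ->
  G * s i * c i k = acoef alpha a T N i k
    + (if Nat.eq_dec i 1 then 0 else bcoef alpha a T N (i - 1) k) - bcoef alpha a T N i k.
Proof.
  intros Hi; assert (H := exponent_bounds).
  assert (HG : 0 < G) by (apply Gamma_pos; lra).
  assert (Hs := log_step_pos i ltac:(lia)).
  unfold c, ccoef; destruct (Nat.eqb_spec k 0); [lia|].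
  destruct (Nat.eqb_spec i 1) as [->|Hi1].
  - change (INR 0) with (INR (1 - 1)).
    rewrite ln_tg_ratio by apply pos_INR.
    destruct (Nat.eq_dec 1 1); [|lia].
    fold G; change (lg (INR 1) - lg (INR (1 - 1))) with (s 1); field; lra.
  - replace ((2 <=? i)%nat && (i <=? k)%nat)%bool with true
      by (symmetry; apply andb_true_intro; split; apply Nat.leb_le; lia).
    rewrite ln_tg_ratio by apply pos_INR.
    destruct (Nat.eq_dec i 1); [lia|].
    fold G; change (lg (INR i) - lg (INR (i - 1))) with (s i); field; lra.
Qed.

Lemma ccoef_last (k : nat) :
  (1 <= k)%nat -> G * s (k + 1) * c (k + 1) k = bcoef alpha a T N k k + Rpower (d k k) p.
Proof.
  intros Hk; assert (H := exponent_bounds).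
  assert (HG : 0 < G) by (apply Gamma_pos; lra).
  assert (Hs := log_step_pos (k + 1) ltac:(lia)).
  unfold c, ccoef; destruct (Nat.eqb_spec k 0); [lia|].
  destruct (Nat.eqb_spec (k + 1) 1); [lia|].
  replace ((2 <=? k + 1)%nat && (k + 1 <=? k)%nat)%bool with false
    by (symmetry; apply Bool.andb_false_intro2, Nat.leb_gt; lia).
  rewrite Nat.eqb_refl; fold sg G.
  rewrite !ln_tg_ratio by (generalize (pos_INR k), (pos_INR (k + 1)); lra).
  rewrite (rpow_pos_eq (lg (INR k + sg) - lg (INR k))) by now apply (log_dist_pos k k).
  assert (E : s (k + 1) = lg (INR (k + 1)) - lg (INR k))
    by (unfold s; replace (k + 1 - 1)%nat with k by lia; reflexivity).
  rewrite E in *; fold p; change (lg (INR k + sg) - lg (INR k)) with (d k k); field; lra.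
Qed.

Lemma bcoef_nonneg (k i : nat) : (1 <= i <= k)%nat -> 0 <= bcoef alpha a T N i k.
Proof.
  intros Hi; rewrite bcoef_log by exact Hi; assert (H := exponent_bounds).
  assert (H1 := log_dist_pred k i).
  assert (H2 := log_step_pos i ltac:(lia)); assert (H3 := log_dist_pos k i ltac:(lia)).
  apply quad_weight_nonneg; [lra | lra | apply log_step_pos; lia].
Qed.

(** Drop b_(i-1) >= 0 and apply [quad_weight_le_tangent] to a_i - b_i. *)
Lemma ccoef_lower (k i : nat) :
  (1 <= i <= k)%nat -> p * Rpower (d k (i - 1)) (p - 1) <= G * c i k.
Proof.
  intros Hi; assert (H := exponent_bounds).
  assert (H1 := log_dist_pred k i); assert (H0 := log_dist_pos k i ltac:(lia)).
  assert (Hs := log_step_pos i ltac:(lia)).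
  apply Rmult_le_reg_l with (s i); [exact Hs|].
  replace (s i * (G * c i k)) with (G * s i * c i k) by ring.
  rewrite ccoef_inner by exact Hi.
  assert (Hb : 0 <= if Nat.eq_dec i 1 then 0 else bcoef alpha a T N (i - 1) k)
    by (destruct (Nat.eq_dec i 1); [lra | apply bcoef_nonneg; lia]).
  assert (Hq := quad_weight_le_tangent p (d k i) (d k (i - 1)) (s (i + 1)) ltac:(lra)
    ltac:(lra) (log_step_pos (i + 1) ltac:(lia))).
  rewrite acoef_log, (bcoef_log k i) by exact Hi; rewrite H1 in Hq; lra.
Qed.

(** Drop -b_i <= 0; the concavity gap between a_i and its tangent bound at d_i absorbs b_(i-1). *)
Lemma ccoef_upper (k i : nat) :
  t <= a -> (1 <= i <= k)%nat -> G * c i k <= p * Rpower (d k i) (p - 1).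
Proof.
  intros Hta Hi; assert (H := exponent_bounds).
  assert (H1 := log_dist_pred k i); assert (H0 := log_dist_pos k i ltac:(lia)).
  assert (Hs := log_step_pos i ltac:(lia)).
  apply Rmult_le_reg_l with (s i); [exact Hs|].
  replace (s i * (G * c i k)) with (G * s i * c i k) by ring.
  rewrite ccoef_inner, acoef_log by exact Hi.
  assert (Hb := bcoef_nonneg k i Hi).
  destruct (Nat.eq_dec i 1) as [E1|E1].
  - assert (Hq := Rpower_tangent_left p ltac:(lra) (d k i) (d k (i - 1)) ltac:(lra)).
    rewrite H1 in Hq; lra.
  - rewrite bcoef_log by lia; replace (i - 1 + 1)%nat with i by lia.
    assert (H2 := log_dist_pred k (i - 1)).
    assert (Hs' := log_step_pos (i - 1) ltac:(lia)).
    assert (Hr := log_step_ratio (i - 1) ltac:(lia) Hta).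
    replace (i - 1 + 1)%nat with i in Hr by lia.
    assert (Hq := trap_absorbed p ltac:(lra) (d k (i - 1)) (d k (i - 1 - 1)) (s i)
      ltac:(lra) ltac:(lra)).
    replace (d k (i - 1) - s i) with (d k i) in Hq by lra.
    unfold quad_weight; lra.
Qed.

(** All logarithms involved are functions of q = tau/t_k <= tau/a, so one threshold on tau/a serves
    every k. *)
Lemma ccoef_gap (k : nat) (delta : R) :
  (forall q, 0 < q < delta -> q < 1 / 2 ->
    0 < last_gap p sg (ln (1 + sg * q)) (ln (1 + sg * q) - ln (1 - q))
         (ln (1 + sg * q) - ln (1 - 2 * q)) (ln (1 + q)) (- ln (1 - q))) ->
  (1 <= k)%nat -> t < a * delta -> t < a / 2 ->
  sg ^ 2 * c k k <= p * c (k + 1) k.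
Proof.
  intros Hgap Hk Hd H2; assert (H := exponent_bounds).
  assert (HG : 0 < G) by (apply Gamma_pos; lra).
  assert (Ht := tau_pos); fold t in Ht.
  assert (Hk' := le_INR _ _ Hk); simpl in Hk'.
  assert (Htk := tg_pos (INR k) ltac:(lra)).
  assert (Hak : a <= tg a T N (INR k)).
  { unfold tg; fold t; assert (0 <= INR k * t) by (apply Rmult_le_pos; lra); lra. }
  set (q := t / tg a T N (INR k)).
  assert (Eq : q * tg a T N (INR k) = t) by (unfold q; field; lra).
  assert (Hq0 : 0 < q) by (unfold q; apply Rdiv_lt_0_compat; lra).
  assert (Hqa : q * a <= t) by (rewrite <- Eq; apply Rmult_le_compat_l; lra).
  assert (Hq1 : q < delta) by (apply Rmult_lt_reg_r with a; lra).
  assert (Hq2 : q < 1 / 2) by (apply Rmult_lt_reg_r with a; lra).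
  specialize (Hgap q (conj Hq0 Hq1) Hq2).
  assert (Hln : forall x, 0 < tg a T N (INR k + x) ->
    ln (1 + x * q) = lg (INR k + x) - lg (INR k)).
  { intros x Hx; unfold lg; rewrite <- ln_div by assumption; f_equal.
    unfold q, tg, t in *; field; lra. }
  assert (E0 : ln (1 + sg * q) = d k k).
  { apply (Hln sg); apply tg_pos; lra. }
  assert (Em : INR (k - 1) = INR k + -1) by (rewrite minus_INR by exact Hk; simpl; ring).
  assert (E1 : ln (1 - q) = - s k).
  { unfold s; rewrite Em.
    replace (1 - q) with (1 + -1 * q) by ring.
    rewrite Hln by (apply tg_pos; lra); ring. }
  assert (E2 : ln (1 + q) = s (k + 1)).
  { unfold s; replace (k + 1 - 1)%nat with k by lia; rewrite plus_INR; simpl (INR 1).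
    replace (1 + q) with (1 + 1 * q) by ring; apply Hln, tg_pos; lra. }
  assert (Hsk := log_step_pos k Hk); assert (Hsk' := log_step_pos (k + 1) ltac:(lia)).
  assert (Hdk := log_dist_pos k k ltac:(lia)).
  assert (Hdp := log_dist_pred k k).
  rewrite E0, E1, E2, Ropp_involutive in Hgap.
  replace (d k k - - s k) with (d k (k - 1)) in Hgap by lra.
  assert (Hlast := ccoef_last k Hk).
  assert (Hin := ccoef_inner k k (conj Hk (le_n k))).
  rewrite acoef_log in Hin by lia.
  rewrite bcoef_log in Hlast by lia; rewrite (bcoef_log k k) in Hin by lia.
  (* For [k = 1] the absent correction is replaced by that of a fictitious node
     t_(-1) = a - tau > 0, so that the same function of [q] covers all [k]. *)
  assert (Hprev : (if Nat.eq_dec k 1 then 0 else bcoef alpha a T N (k - 1) k)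
    <= quad_weight p (d k (k - 1)) (d k k - ln (1 - 2 * q)) (s k)).
  { assert (Hl : ln (1 - 2 * q) < - s k) by (rewrite <- E1; apply ln_increasing; lra).
    destruct (Nat.eq_dec k 1) as [K1|K1].
    - apply quad_weight_nonneg; lra.
    - rewrite bcoef_log by lia; replace (k - 1 + 1)%nat with k by lia.
      apply Req_le; f_equal.
      assert (K2 := le_INR 2 k ltac:(lia)); simpl in K2.
      replace (1 - 2 * q) with (1 + -2 * q) by ring.
      rewrite Hln by (apply tg_pos; lra).
      unfold d; replace (INR (k - 1 - 1)) with (INR k + -2)
        by (rewrite !minus_INR by lia; simpl; ring); ring. }
  unfold last_gap in Hgap.
  set (Bk := quad_weight p (d k k) (d k (k - 1)) (s (k + 1))) in *.
  set (Bv := quad_weight p (d k (k - 1)) _ (s k)) in *.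
  set (Bp := if Nat.eq_dec k 1 then 0 else bcoef alpha a T N (k - 1) k) in *.
  (* Clearing both denominators yields the expression in [last_gap], up to the replacement in
     [Hprev]. *)
  apply Rmult_le_reg_l with (G * s k * s (k + 1));
    [apply Rmult_lt_0_compat; [apply Rmult_lt_0_compat|]; assumption|].
  replace (G * s k * s (k + 1) * (sg ^ 2 * c k k))
    with (sg ^ 2 * (G * s k * c k k) * s (k + 1)) by ring.
  replace (G * s k * s (k + 1) * (p * c (k + 1) k))
    with (p * (G * s (k + 1) * c (k + 1) k) * s k) by ring.
  rewrite Hlast, Hin.
  assert (0 <= sg ^ 2 * s (k + 1)) by (apply Rmult_le_pos; [apply pow2_ge_0 | lra]).
  assert (H3 := Rmult_le_compat_l _ _ _ H0 Hprev); lra.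
Qed.

(** The upper bound for c_i is the lower bound for c_(i+1) while i < k. For the last pair, p = 2
    sigma - 1 <= sigma^2 turns the gap condition into monotonicity. *)
Lemma ccoef_mono (k i : nat) :
  t <= a -> ((1 <= k)%nat -> sg ^ 2 * c k k <= p * c (k + 1) k) ->
  (1 <= i <= k)%nat -> c i k <= c (i + 1) k.
Proof.
  intros Hta Hgap Hi; assert (H := exponent_bounds).
  assert (HG : 0 < G) by (apply Gamma_pos; lra).
  destruct (Nat.eq_dec i k) as [->|Hik].
  - specialize (Hgap (proj1 Hi)); assert (Hl := ccoef_lower k k Hi).
    assert (0 <= c k k).
    { apply Rmult_le_reg_l with G; [exact HG|]; rewrite Rmult_0_r.
      eapply Rle_trans; [|exact Hl]; apply Rmult_le_pos; [lra|].
      left; apply Rpower_pos. }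
    assert (p <= sg ^ 2) by nra.
    assert (p * c k k <= sg ^ 2 * c k k) by (apply Rmult_le_compat_r; lra).
    apply Rmult_le_reg_l with p; lra.
  - apply Rmult_le_reg_l with G; [exact HG|].
    apply Rle_trans with (p * Rpower (d k i) (p - 1)); [now apply ccoef_upper|].
    replace (d k i) with (d k (i + 1 - 1)) by (f_equal; lia).
    apply ccoef_lower; lia.
Qed.

(** G c_(1,k) >= p d^(-alpha) with d = ln(1 + (k+sigma) tau/a) <= (k+sigma) tau/a; the single weight
    at k = 0 has its own formula and is treated apart. *)
Lemma ccoef_first_lower (k : nat) :
  p * Rpower a alpha <= G * c 1 k * Rpower ((INR k + sg) * t) alpha.
Proof.
  assert (H := exponent_bounds).
  assert (HG : 0 < G) by (apply Gamma_pos; lra).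
  assert (Ht := tau_pos); fold t in Ht; assert (Hk := pos_INR k).
  assert (Hx : 0 < (INR k + sg) * t) by (apply Rmult_lt_0_compat; lra).
  assert (Hd := log_dist_pos k 0 ltac:(lia)).
  assert (Hc : p * Rpower (d k 0) (- alpha) <= G * c 1 k).
  { replace (- alpha) with (p - 1) by (unfold p; ring).
    destruct (Nat.eq_dec k 0) as [->|Hk0].
    - unfold c, ccoef; cbn [Nat.eqb]; fold G sg p.
      rewrite !ln_tg_ratio by (simpl; lra).
      change (lg (INR 0 + sg) - lg (INR 0)) with (d 0 0).
      change (lg (INR 1) - lg (INR 0)) with (s 1).
      assert (Hs := log_step_pos 1 ltac:(lia)).
      rewrite rpow_pos_eq by exact Hd; rewrite Rpower_pred by exact Hd.
      (* With x = tau/a this is p ln(1 + x) <= ln(1 + sigma x): equality at 0, and the difference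
         increases because p < sigma. *)
      assert (Hps : p * s 1 <= d 0 0).
      { set (x := t / a).
        assert (Hx0 : 0 < x) by (apply Rdiv_lt_0_compat; lra).
        assert (E1 : s 1 = ln (1 + x)).
        { unfold s, lg; rewrite <- ln_div by (apply tg_pos; simpl; lra); f_equal.
          unfold tg; simpl; unfold x; fold t; field; lra. }
        assert (E2 : d 0 0 = ln (1 + sg * x)).
        { unfold d, lg; rewrite <- ln_div by (apply tg_pos; simpl; lra); f_equal.
          unfold tg; simpl; unfold x; fold t; field; lra. }
        rewrite E1, E2.
        enough (ln (1 + sg * 0) - p * ln (1 + 0) <= ln (1 + sg * x) - p * ln (1 + x))
          by (rewrite Rmult_0_r, Rplus_0_r, ln_1 in *; lra).
        apply (nonneg_derive_le (fun x => ln (1 + sg * x) - p * ln (1 + x))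
          (fun x => (sg - p + sg * (1 - p) * x) / ((1 + sg * x) * (1 + x)))); [lra | |].
        - intros y Hy; assert (0 <= sg * y) by (apply Rmult_le_pos; lra).
          auto_derive; [lra | field; lra].
        - intros y Hy; assert (0 <= sg * y) by (apply Rmult_le_pos; lra).
          apply Rdiv_le_0_compat; [|apply Rmult_lt_0_compat; lra].
          assert (0 <= sg * (1 - p) * y)
            by (apply Rmult_le_pos; [apply Rmult_le_pos|]; lra); lra. }
      assert (HP := Rpower_pos (d 0 0) p).
      replace (G * (Rpower (d 0 0) p / (G * s 1)))
        with (Rpower (d 0 0) p / d 0 0 * (d 0 0 / s 1)) by (field; lra).
      rewrite (Rmult_comm p); apply Rmult_le_compat_l.
      + left; now apply Rdiv_lt_0_compat.
      + apply Rmult_le_reg_r with (s 1); [exact Hs|].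
        unfold Rdiv; rewrite Rmult_assoc, Rinv_l; lra.
    - apply (ccoef_lower k 1); lia. }
  assert (Hd' : d k 0 <= (INR k + sg) * t / a).
  { unfold d, lg; rewrite <- ln_div by (apply tg_pos; simpl; lra).
    replace (tg a T N (INR k + sg) / tg a T N (INR 0)) with (1 + (INR k + sg) * t / a)
      by (unfold tg; simpl; unfold t; field; lra).
    assert (Hy : 0 < (INR k + sg) * t / a) by (apply Rdiv_lt_0_compat; lra).
    rewrite <- (ln_exp ((INR k + sg) * t / a)) at 2.
    apply ln_le; [lra | left; apply exp_ineq1; lra]. }
  assert (Hpow : Rpower a alpha <= Rpower (d k 0) (- alpha) * Rpower ((INR k + sg) * t) alpha).
  { apply Rle_trans with
      (Rpower ((INR k + sg) * t / a) (- alpha) * Rpower ((INR k + sg) * t) alpha).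
    - apply Req_le.
      set (X := (INR k + sg) * t) in *.
      replace (Rpower X alpha) with (Rpower (X / a) alpha * Rpower a alpha).
      + rewrite Rpower_Ropp; assert (Hxa := Rpower_pos (X / a) alpha); field; lra.
      + rewrite Rpower_mult_distr by (try apply Rdiv_lt_0_compat; lra); f_equal; field; lra.
    - apply Rmult_le_compat_r; [left; apply Rpower_pos|].
      apply Rpower_anti; lra. }
  eapply Rle_trans; [apply Rmult_le_compat_l; [|exact Hpow]; lra|].
  rewrite <- Rmult_assoc; apply Rmult_le_compat_r; [left; apply Rpower_pos | exact Hc].
Qed.
End Mesh.

(** * Stability *)

Definition grid_dot (M : nat) (v w : nat -> nat -> R) : R :=
  sum1 (M - 1) (fun j => sum1 (M - 1) (fun k => v j k * w j k)).

Lemma normL2sq_grid_dot (L : R) (M : nat) (w : nat -> nat -> R) :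
  normL2sq L M w = hstep L M ^ 2 * grid_dot M w w.
Proof.
  change (normL2sq L M w)
    with (hstep L M ^ 2 * sum1 (M - 1) (fun j => sum1 (M - 1) (fun k => w j k ^ 2))).
  unfold grid_dot; f_equal; apply sum1_ext; intros; apply sum1_ext; intros; ring.
Qed.

Lemma grid_sum_increments (M m : nat) (c : nat -> R) (U : nat -> nat -> nat -> R) :
  sum1 (M - 1) (fun j => sum1 (M - 1) (fun k =>
    sum1 m (fun i => c i * (U i j k ^ 2 - U (i - 1)%nat j k ^ 2))))
  = sum1 m (fun i => c i * (grid_dot M (U i) (U i) - grid_dot M (U (i - 1)%nat) (U (i - 1)%nat))).
Proof.
  rewrite (sum1_ext _ (fun j => sum1 m (fun i => sum1 (M - 1) (fun k =>
    c i * (U i j k ^ 2 - U (i - 1)%nat j k ^ 2))))) by (intros; apply sum1_swap).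
  rewrite sum1_swap; apply sum1_ext; intros i _.
  replace (grid_dot M (U i) (U i) - grid_dot M (U (i - 1)%nat) (U (i - 1)%nat))
    with (grid_dot M (U i) (U i) + -1 * grid_dot M (U (i - 1)%nat) (U (i - 1)%nat)) by ring.
  unfold grid_dot; rewrite <- sum1_scal, <- sum1_plus, <- sum1_scal.
  apply sum1_ext; intros j _.
  rewrite <- sum1_scal, <- sum1_plus, <- sum1_scal.
  apply sum1_ext; intros k _; ring.
Qed.

(** The pointwise energy inequality is summed over the grid. Young's inequality 2VF <= 2 lambda V^2
    + F^2/(2 lambda) produces a multiple of |V|^2 that coercivity cancels. *)
Lemma time_step_energy (M m : nat) (c : nat -> R) (s lambda : R)
  (U : nat -> nat -> nat -> R) (Lap F : nat -> nat -> R) :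
  let V := fun j k => s * U m j k + (1 - s) * U (m - 1)%nat j k in
  (1 <= m)%nat -> 1 / 2 <= s -> 0 < lambda -> 0 <= c 1%nat ->
  (forall i, (1 <= i)%nat -> (i < m)%nat -> c i <= c (S i)) ->
  (forall i, (1 <= i)%nat -> m = S i -> s ^ 2 * c i <= (2 * s - 1) * c m) ->
  lambda * grid_dot M V V <= grid_dot M V Lap ->
  (forall j k, (1 <= j <= M - 1)%nat -> (1 <= k <= M - 1)%nat ->
    sum1 m (fun i => c i * (U i j k - U (i - 1)%nat j k)) + Lap j k = F j k) ->
  sum1 m (fun i => c i * (grid_dot M (U i) (U i) - grid_dot M (U (i - 1)%nat) (U (i - 1)%nat)))
  <= grid_dot M F F / (2 * lambda).
Proof.
  intros V Hm Hs Hlam Hc1 Hmono Hlast Hcoer Heq.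
  rewrite <- grid_sum_increments.
  set (D := fun j k => sum1 m (fun i => c i * (U i j k ^ 2 - U (i - 1)%nat j k ^ 2))).
  change (sum1 (M - 1) (fun j => sum1 (M - 1) (D j)) <= grid_dot M F F / (2 * lambda)).
  assert (Hpt : sum1 (M - 1) (fun j => sum1 (M - 1) (fun k =>
      D j k + (2 * (V j k * Lap j k) + -2 * lambda * (V j k * V j k))))
    <= sum1 (M - 1) (fun j => sum1 (M - 1) (fun k => / (2 * lambda) * (F j k * F j k)))).
  { apply sum1_le; intros j Hj; apply sum1_le; intros k Hk.
    assert (H := convex_combination_energy c (fun i => U i j k) s m Hm Hs Hc1 Hmono Hlast).
    cbv beta in H; fold (D j k) in H; fold (V j k) in H.
    replace (sum1 m (fun i => c i * (U i j k - U (i - 1)%nat j k))) with (F j k - Lap j k) in H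
      by (rewrite <- (Heq j k Hj Hk); ring).
    assert (Hsq := pow2_ge_0 (2 * lambda * V j k - F j k)).
    assert (Hyoung : 0 <= / (2 * lambda) * (2 * lambda * V j k - F j k) ^ 2)
      by (apply Rmult_le_pos; [left; apply Rinv_0_lt_compat|]; lra).
    replace (/ (2 * lambda) * (2 * lambda * V j k - F j k) ^ 2)
      with (2 * lambda * (V j k * V j k) - 2 * (V j k * F j k) + / (2 * lambda) * (F j k * F j k))
      in Hyoung by (field; lra).
    lra. }
  assert (Hlhs : sum1 (M - 1) (fun j => sum1 (M - 1) (fun k =>
      D j k + (2 * (V j k * Lap j k) + -2 * lambda * (V j k * V j k))))
    = sum1 (M - 1) (fun j => sum1 (M - 1) (D j))
      + (2 * grid_dot M V Lap + -2 * lambda * grid_dot M V V)).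
  { unfold grid_dot; rewrite <- !sum1_scal, <- !sum1_plus; apply sum1_ext; intros j _.
    now rewrite <- !sum1_scal, <- !sum1_plus. }
  assert (Hrhs : sum1 (M - 1) (fun j => sum1 (M - 1) (fun k => / (2 * lambda) * (F j k * F j k)))
    = / (2 * lambda) * grid_dot M F F).
  { unfold grid_dot; rewrite <- sum1_scal; apply sum1_ext; intros j _; apply sum1_scal. }
  unfold Rdiv; lra.
Qed.

(** By the Abel bound, c_m y_m <= load + (c_m - c_1) E + c_1 y_0 <= c_m E, and c_m >= c_1 > 0 allows
    division. *)
Lemma weighted_history_bound (c y : nat -> R) (E load : R) (m : nat) :
  (1 <= m)%nat -> 0 < c 1%nat ->
  (forall i, (1 <= i)%nat -> (i < m)%nat -> c i <= c (S i)) ->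
  (forall i, (1 <= i)%nat -> (i < m)%nat -> y i <= E) ->
  sum1 m (fun i => c i * (y i - y (i - 1)%nat)) <= load ->
  load <= c 1%nat * (E - y 0%nat) ->
  y m <= E.
Proof.
  intros Hm Hc1 Hmono Hy Hsum Hload.
  assert (H := sum1_increments_lower_bound c y E m Hm Hmono Hy).
  assert (Hcm : forall i, (1 <= i)%nat -> (i <= m)%nat -> c 1%nat <= c i).
  { intros i Hi; induction i as [|i IH]; [lia|]; intros Him.
    destruct i as [|i]; [lra|].
    eapply Rle_trans; [apply IH; lia | apply Hmono; lia]. }
  specialize (Hcm m Hm (le_n m)).
  apply Rmult_le_reg_l with (c m); lra.
Qed.

Theorem theorem3p3 (alpha beta a T L : R) :
  0 < alpha < 1 -> 1 < beta < 2 -> 0 < a -> a < T -> 0 < L ->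
  exists C : R, 0 < C /\
  exists tau0 h0 : R, 0 < tau0 /\ 0 < h0 /\
  forall (N M : nat), (1 <= N)%nat -> (1 <= M)%nat ->
    tau a T N <= tau0 -> hstep L M <= h0 ->
  forall (u0 : R -> R -> R) (f : R -> R -> R -> R) (U : nat -> nat -> nat -> R),
    is_scheme_solution alpha beta a T L N M u0 f U ->
  forall n : nat, (1 <= n <= N)%nat ->
    normL2sq L M (U n)
    <= normL2sq L M (U 0%nat)
       + 8 * Rpower PI (2 + beta) * Gamma (1 - alpha)
         / (C * Rpower a alpha * Rpower 2 (3 * beta / 2))
         * maxupto (fun k => Rpower ((INR k + sgm alpha) * tau a T N) alpha
                             * normL2sq L M (Fgrid alpha a T L N M f k)) (n - 1).
Proof.
  intros Halpha Hbeta Ha HT HL.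
  assert (HG1 : 0 < Gamma (1 - alpha)) by (apply Gamma_pos; lra).
  assert (HG2 : 0 < Gamma (2 - alpha)) by (apply Gamma_pos; lra).
  assert (Hs : 1 / 2 < sgm alpha < 1) by (unfold sgm; lra).
  assert (Hps : 2 * sgm alpha - 1 = 1 - alpha) by (unfold sgm; field).
  destruct (last_gap_pos_eventually (sgm alpha) Hs) as [delta [Hdelta Hgap]].
  rewrite Hps in Hgap.
  set (lambda := 1 / 2 * Rpower (8 * L) (- beta)).
  assert (Hlam : 0 < lambda) by (unfold lambda; generalize (Rpower_pos (8 * L) (- beta)); lra).
  assert (HPI := Rpower_pos PI (2 + beta)).
  assert (H2b := Rpower_pos 2 (3 * beta / 2)).
  assert (Haa := Rpower_pos a alpha).
  (* Chosen so that the prescribed coefficient collapses to the [K] below; it depends only on alpha,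
     beta and L. *)
  exists (8 * Rpower PI (2 + beta) * Gamma (1 - alpha) * (2 * lambda * (1 - alpha))
    / (Gamma (2 - alpha) * Rpower 2 (3 * beta / 2))).
  split.
  { apply Rdiv_lt_0_compat; [|now apply Rmult_lt_0_compat].
    repeat first [lra | apply Rmult_lt_0_compat]. }
  (* Half of the bounds a/2 and a delta in [ccoef_gap], which are strict. *)
  exists (Rmin (a / 4) (a * delta / 2)), 1.
  assert (Had : 0 < a * delta) by now apply Rmult_lt_0_compat.
  split; [apply Rmin_glb_lt; lra|]; split; [lra|].
  intros N M HN HM Htau _ u0 f U [_ [_ Hscheme]].
  assert (Htau1 := Rle_trans _ _ _ Htau (Rmin_l _ _)).
  assert (Htau2 := Rle_trans _ _ _ Htau (Rmin_r _ _)).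
  replace (8 * Rpower PI (2 + beta) * Gamma (1 - alpha) / _)
    with (Gamma (2 - alpha) / (2 * lambda * (1 - alpha) * Rpower a alpha))
    by (field; repeat split; lra).
  set (K := Gamma (2 - alpha) / (2 * lambda * (1 - alpha) * Rpower a alpha)).
  assert (HK : 0 < K).
  { apply Rdiv_lt_0_compat; [exact HG2|]; repeat first [lra | apply Rmult_lt_0_compat]. }
  set (g := fun k => Rpower ((INR k + sgm alpha) * tau a T N) alpha
                     * normL2sq L M (Fgrid alpha a T L N M f k)).
  (* Strong induction: the running maximum is monotone, so the bound at n also dominates all earlier
     norms. The step k = n - 1 produces U^n. *)
  intros n; induction n as [n IH] using (well_founded_induction lt_wf); intros Hn.
  set (k := (n - 1)%nat); set (c := fun i => ccoef alpha a T N i k).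
  assert (Hlast : (1 <= k)%nat -> sgm alpha ^ 2 * c k <= (1 - alpha) * c (k + 1)%nat).
  { intros Hk; apply (ccoef_gap alpha a T N Halpha Ha HT HN k delta Hgap Hk); lra. }
  assert (Hmono : forall i, (1 <= i)%nat -> (i < n)%nat -> c i <= c (S i)).
  { intros i Hi Hin; replace (S i) with (i + 1)%nat by lia.
    apply (ccoef_mono alpha a T N Halpha Ha HT HN k i);
      [lra | exact Hlast | unfold k; lia]. }
  set (X := Rpower ((INR k + sgm alpha) * tau a T N) alpha).
  assert (Hfirst : (1 - alpha) * Rpower a alpha <= Gamma (2 - alpha) * c 1%nat * X)
    by exact (ccoef_first_lower alpha a T N Halpha Ha HT HN k).
  assert (HX : 0 < X) by apply Rpower_pos.
  assert (Hc1 : 0 < c 1%nat).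
  { apply Rmult_lt_reg_l with (Gamma (2 - alpha)); [exact HG2|].
    apply Rmult_lt_reg_r with X; [exact HX|].
    rewrite Rmult_0_r, Rmult_0_l; eapply Rlt_le_trans; [|exact Hfirst].
    apply Rmult_lt_0_compat; lra. }
  set (F := Fgrid alpha a T L N M f k).
  assert (Henergy : sum1 n (fun i => c i *
      (grid_dot M (U i) (U i) - grid_dot M (U (i - 1)%nat) (U (i - 1)%nat)))
    <= grid_dot M F F / (2 * lambda)).
  { apply (time_step_energy M n c (sgm alpha) lambda U
      (fracLap beta L M (fun j l => sgm alpha * U n j l + (1 - sgm alpha) * U (n - 1)%nat j l)) F);
      try lia; try lra; [exact Hmono | | |].
    - intros i Hi E; rewrite Hps; replace n with (k + 1)%nat by (unfold k; lia).
      replace i with k by (unfold k; lia); apply Hlast; unfold k; lia.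
    - eapply Rle_trans; [|apply fracLap_coercive; [lra | exact HL | exact HM]].
      apply Req_le; fold lambda; unfold grid_dot; f_equal.
      apply sum1_ext; intros; apply sum1_ext; intros; ring.
    - intros j l Hj Hl.
      assert (E := Hscheme k j l ltac:(unfold k; lia) HN Hj Hl).
      replace (k + 1)%nat with n in E by (unfold k; lia); exact E. }
  assert (Hh : 0 <= hstep L M ^ 2) by apply pow2_ge_0.
  apply (weighted_history_bound c (fun i => normL2sq L M (U i)) _
    (normL2sq L M F / (2 * lambda)) n);
    [lia | exact Hc1 | exact Hmono | | |].
  - intros i Hi Hin; eapply Rle_trans; [apply IH; lia|].
    apply Rplus_le_compat_l, Rmult_le_compat_l; [lra | apply maxupto_mono; lia].
  - rewrite normL2sq_grid_dot.
    replace (_ * grid_dot M F F / (2 * lambda))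
      with (hstep L M ^ 2 * (grid_dot M F F / (2 * lambda))) by (unfold Rdiv; ring).
    eapply Rle_trans; [|apply Rmult_le_compat_l; [exact Hh | exact Henergy]].
    rewrite <- sum1_scal; apply Req_le, sum1_ext; intros i _.
    rewrite !normL2sq_grid_dot; ring.
  - assert (Hg : X * normL2sq L M F <= maxupto g k) by apply (maxupto_le g k k (le_n k)).
    assert (HF : 0 <= normL2sq L M F).
    { rewrite normL2sq_grid_dot; apply Rmult_le_pos; [exact Hh|].
      apply sum1_nonneg; intros; apply sum1_nonneg; intros; apply Rle_0_sqr. }
    (* [Hfirst] says precisely that c_1 K X >= 1/(2 lambda), so the load fits into the increment of
       the bound over the initial norm. *)
    apply Rle_trans with (c 1%nat * (K * (X * normL2sq L M F))).
    + assert (Hr : 0 <= normL2sq L M F / (2 * lambda * (1 - alpha) * Rpower a alpha)).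
      { apply Rdiv_le_0_compat; [exact HF|]; repeat first [lra | apply Rmult_lt_0_compat]. }
      assert (H := Rmult_le_compat_r _ _ _ Hr Hfirst).
      replace (normL2sq L M F / (2 * lambda)) with
        ((1 - alpha) * Rpower a alpha
         * (normL2sq L M F / (2 * lambda * (1 - alpha) * Rpower a alpha))) by (field; lra).
      eapply Rle_trans; [exact H|]; apply Req_le; unfold K; field; lra.
    + apply Rmult_le_compat_l; [lra|].
      rewrite Rplus_comm; unfold Rminus; rewrite Rplus_assoc, Rplus_opp_r, Rplus_0_r.
      apply Rmult_le_compat_l; [lra | exact Hg].
Qed.
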